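(* Let $\Lambda$ be a finite index set, let $r\in\mathbb{Q}$ with $0<r<1$, let $a_i\in\mathbb{Q}$ for $i\in\Lambda$, and let $\Phi=\{f_i\}_{i\in\Lambda}$ with $f_i(x)=rx+a_i$ be the corresponding iterated function system on $\mathbb{R}$, assumed to contain at least two distinct maps. Let $X\subseteq\mathbb{R}$ be the self-similar set defined by $\Phi$. If $$\dim_{\mathrm{B}} X<\min\left\{1,\frac{\log|\Lambda|}{\log(1/r)}\right\},$$ then $\Phi$ has exact overlaps, i.e. there exist $n\in\mathbb{N}$ and distinct $\underline{i},\underline{j}\in\Lambda^n$ such that $f_{\underline{i}}=f_{\underline{j}}$.
   Context: The self-similar set $X$ defined by $\Phi=\{f_i\}_{i\in\Lambda}$ is the unique non-empty compact set $X\subseteq\mathbb{R}$ satisfying $X=\bigcup_{i\in\Lambda}f_i(X)$. For $\underline{i}=i_1\ldots i_n\in\Lambda^n$ write $f_{\underline{i}}=f_{i_1}\circ\cdots\circ f_{i_n}$. For $Y\subseteq\mathbb{R}$ and $\varepsilon>0$ let $N_\varepsilon(Y)$ be the minimal number of sets of diameter $\le\varepsilon$ needed to cover $Y$; the box dimension is $\dim_{\mathrm{B}}Y=\lim_{\varepsilon\to0}\frac{\log N_\varepsilon(Y)}{\log(1/\varepsilon)}$, which exists when $Y$ is self-similar (and then equals the Hausdorff dimension). One always has $\dim_{\mathrm{B}}X\le\min\{1,\log|\Lambda|/\log(1/r)\}$. *)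

(* Defs.v *)
From HB Require Import structures.
From mathcomp Require Export all_boot all_order all_algebra.
From mathcomp Require Export all_classical all_reals all_analysis.
Export Order.TTheory GRing.Theory Num.Theory.
Export numFieldNormedType.Exports.

Set Implicit Arguments.
Unset Strict Implicit.
Unset Printing Implicit Defensive.

Local Open Scope classical_set_scope.
Local Open Scope ring_scope.

Definition diam_le (R : realType) (eps : R) (U : set R) : Prop :=
  forall x y, U x -> U y -> `|x - y| <= eps.

Definition coverable (R : realType) (eps : R) (Y : set R) (n : nat) : Prop :=
  exists U : 'I_n -> set R,
    (forall k, diam_le eps (U k)) /\ Y `<=` \bigcup_k U k.

(* The default value 0 is returned when no finite cover exists, which does not
   happen for bounded [Y] and [0 < eps]. *)
Definition covering_number (R : realType) (eps : R) (Y : set R) : nat :=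
  xget 0%N [set n | coverable eps Y n /\
                    forall m, coverable eps Y m -> (n <= m)%N].

(* As with every [lim], this is meaningful only when the limit exists, as it
   does for self-similar [Y]. *)
Definition box_dim (R : realType) (Y : set R) : R :=
  lim (ln (covering_number eps Y)%:R / ln (1 / eps) @[eps --> (0 : R)^'+]).

Definition ifs_map (R : realType) (L : finType) (r : rat) (a : L -> rat)
  (i : L) : R -> R := fun x => ratr r * x + ratr (a i).

(* For contractions [f], Hutchinson's theorem gives exactly one such [X]. *)
Definition self_similar_set (R : realType) (L : finType) (f : L -> R -> R)
    (X : set R) : Prop :=
  [/\ X !=set0, compact X & X = \bigcup_i (f i @` X)].

Definition word_map (R : realType) (L : finType) (f : L -> R -> R)
  (w : seq L) : R -> R := foldr (fun i g => f i \o g) id w.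

Definition exact_overlaps (R : realType) (L : finType) (f : L -> R -> R)
    : Prop :=
  exists (n : nat) (u v : n.-tuple L),
    u <> v /\ word_map f u = word_map f v.

(* Main.v *)
Require Import Defs.
From mathcomp Require Import ring lra zify.

(* Write r = p/q and suppose that there are no exact overlaps.  Then the sums
   S_n of the scaled digits attached to the words of length n are m^n distinct
   integers, m = #|Lambda|, and their entropy h_n at scale p^n is nearly
   superadditive, hence linear with some rate alpha.  Since
   h_n <= ln N(r^n) + O(1), it suffices that alpha >= min (ln m) (ln (1/r)).

   If not, a typical window of length p^n contains a set B of exponentially many
   points of S_n, and S_{n+J} = q^J S_n + p^n S_J forces H(q^J B + p^n S_J) to
   exceed H(p^n S_J) by only o(n).  By the Kaimanovich-Vershik inequality the
   same holds with B replaced by a bounded number N of summands B + ... + B.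
   But B branches at a positive proportion of the scales, and at such a scale
   a long sum of copies of B contains, up to a small fraction of its mass, long
   chains with bounded gaps, so its entropy grows at almost the full rate
   there, whereas at every other scale the entropy of p^n S_J grows at rate
   alpha.  Adding up over the scales contradicts the o(n) bound. *)

Set Implicit Arguments.
Unset Strict Implicit.
Unset Printing Implicit Defensive.

Local Open Scope classical_set_scope.
Local Open Scope ring_scope.

(** Where [B] comes from: without overlaps [S_n] has entropy exactly [n ln m], but at scale [p^n] it
    shows only about [alpha n], so the missing [n (ln m - alpha)] sits inside windows of length
    [p^n]. The scales at which [B] branches are not under control. Multiplication by [q^J], with [J]
    a fixed multiple of [n] such that [q^J >= p^(n+J)], moves all of them between [p^(n+J)] and
    [p^n q^J], where [p^n S_J] grows at rate about [alpha] at every scale, so that branching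
    anywhere shows up as an excess. Branching alone gives a sum of copies of [B] only a small
    positive chance to fall into a long chain. More copies bring the chance close to 1; how many
    depends on the branching threshold and on the window of scales, never on [n], so the excess
    stays [o(n)]. The full rate is [ln 2] per doubling of the scale, against
    [ln 2 * alpha / ln (1/r)] elsewhere: here [alpha < ln (1/r)] is used, while [alpha < ln m] makes
    [B] large. *)

Lemma ln_le_sub1 (R : realType) (x : R) : 0 < x -> ln x <= x - 1.
Proof.
move=> x0; rewrite -{1}(subrK 1 x) addrC; apply: le_ln1Dx; lra.
Qed.

(** * Entropy of finite multisets *)

Section Entropy.
Variable R : realType.

(** A list stands for a random variable: this is the Shannon entropy of an entry drawn uniformly, an
    entry with count [k] having probability [k / size s]. The empty list gets 0, since
    [ln 0 = 0]. *)
Definition entropy (T : eqType) (s : seq T) : R :=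
  ln (size s)%:R - (\sum_(x <- s) ln (count_mem x s)%:R) / (size s)%:R.

Lemma sumr_count (T : Type) (p : pred T) (s : seq T) :
  \sum_(x <- s) (p x)%:R = (count p s)%:R :> R.
Proof.
elim: s => [|x s IH]; first by rewrite big_nil.
by rewrite big_cons IH /= natrD.
Qed.

Lemma ent_map (T U : eqType) (f : T -> U) (s : seq T) :
  entropy [seq f x | x <- s] = ln (size s)%:R -
    (\sum_(x <- s) ln (count (fun y => f y == f x) s)%:R) / (size s)%:R.
Proof.
rewrite /entropy size_map big_map; congr (_ - _ / _).
by apply: eq_bigr => x _; rewrite count_map; congr (ln _%:R); apply: eq_count.
Qed.

Lemma ent_nil (T : eqType) : entropy ([::] : seq T) = 0.
Proof. by rewrite /entropy /= big_nil ln0 // mul0r subr0. Qed.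

Lemma ent_perm (T : eqType) (s t : seq T) : perm_eq s t -> entropy s = entropy t.
Proof.
move=> st; rewrite /entropy (perm_size st); congr (_ - _ / _).
rewrite (perm_big _ st) /=; apply: eq_bigr => x _.
by congr (ln _%:R); apply/permP.
Qed.

Lemma ent_inj (T U V : eqType) (f : T -> U) (g : T -> V) (s : seq T) :
  {in s &, forall x y, (f x == f y) = (g x == g y)} ->
  entropy [seq f x | x <- s] = entropy [seq g x | x <- s].
Proof.
move=> fg; rewrite !ent_map; congr (_ - _ / _).
rewrite big_seq [RHS]big_seq; apply: eq_bigr => x xs; congr (ln _%:R).
by apply: eq_in_count => y ys; apply: fg.
Qed.

Lemma ent_inj1 (T U : eqType) (f : T -> U) (s : seq T) :
  {in s &, injective f} -> entropy [seq f x | x <- s] = entropy s.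
Proof.
move=> fi; rewrite -[in RHS](map_id s); apply: ent_inj => x y xs ys.
by apply/eqP/eqP => [/fi|->]; auto.
Qed.

Lemma ent_uniq (T : eqType) (s : seq T) : uniq s -> entropy s = ln (size s)%:R.
Proof.
move=> us; rewrite /entropy big_seq big1 ?mul0r ?subr0 // => x xs.
by rewrite count_uniq_mem // xs ln1.
Qed.

(* The product [n_xz n_yz / (n_xyz n_z)] of fibre sizes sums to at most the
   size of the sample space; concavity of [ln] gives the rest. *)
Lemma submod_sum (T A B C : eqType) (f : T -> A) (g : T -> B) (h : T -> C)
    (s : seq T) :
  \sum_(w <- s)
    (count (fun v => (f v == f w) && (h v == h w)) s)%:R *
    (count (fun v => (g v == g w) && (h v == h w)) s)%:R /
    ((count (fun v => [&& f v == f w, g v == g w & h v == h w]) s)%:R *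
     (count (fun v => h v == h w) s)%:R) <= (size s)%:R :> R.
Proof.
set N := fun w => (count (fun v => [&& f v == f w, g v == g w & h v == h w]) s).
set K := fun w => (count (fun v => h v == h w) s).
have -> : \sum_(w <- s)
    (count (fun v => (f v == f w) && (h v == h w)) s)%:R *
    (count (fun v => (g v == g w) && (h v == h w)) s)%:R /
    ((N w)%:R * (K w)%:R) =
  \sum_(u <- s) \sum_(v <- s) \sum_(w <- s)
    ((f u == f w) && (h u == h w))%:R * ((g v == g w) && (h v == h w))%:R /
    ((N w)%:R * (K w)%:R) :> R.
  under [RHS]eq_bigr => u _ do rewrite exchange_big /=.
  rewrite [RHS]exchange_big /=; apply: eq_bigr => w _.
  rewrite -!sumr_count !mulr_suml; apply: eq_bigr => u _.
  by rewrite mulr_sumr mulr_suml.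
have -> : (size s)%:R = \sum_(u <- s) \sum_(v <- s) (h v == h u)%:R / (K u)%:R :> R.
  rewrite -sum1_size natr_sum big_seq [RHS]big_seq; apply: eq_bigr => u us.
  rewrite -mulr_suml sumr_count divff // pnatr_eq0 -lt0n -has_count.
  by apply/hasP; exists u.
apply: ler_sum => u _; apply: ler_sum => v _.
case: (altP (h v =P h u)) => huv; last first.
  rewrite mul0r big1 // => w _.
  case: eqP => //= _; rewrite ?mul0r //.
  case: eqP => //= hu; rewrite ?mul0r //.
  by rewrite -hu (negbTE huv) andbF mulr0 mul0r.
(* For fixed [u] and [v] the nonzero terms are those with [w] in [P], where [N w] and [K w] are
   constant. They add up to [1 / K u], or to 0 when [P] is empty, whence an inequality. *)
set P := fun w => [&& f w == f u, g w == g v & h w == h u].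
have -> : \sum_(w <- s) ((f u == f w) && (h u == h w))%:R *
   ((g v == g w) && (h v == h w))%:R / ((N w)%:R * (K w)%:R) =
  \sum_(w <- s) (P w)%:R * ((count P s)%:R^-1 * (K u)%:R^-1) :> R.
  apply: eq_bigr => w _; rewrite -natrM mulnb huv.
  have -> : ((f u == f w) && (h u == h w) && ((g v == g w) && (h u == h w))) = P w.
    rewrite /P (eq_sym (f u)) (eq_sym (h u)) (eq_sym (g v)).
    by case: (f w == _); case: (h w == _); case: (g w == _).
  case Pw: (P w); last by rewrite !mul0r.
  move: Pw => /and3P[/eqP fw /eqP gw /eqP hw].
  by rewrite !mul1r invfM /N /K fw gw hw.
rewrite -mulr_suml sumr_count mul1r mulrA.
have [->|c0] := eqVneq (count P s) 0%N; first by rewrite !mul0r invr_ge0.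
by rewrite divff ?mul1r // pnatr_eq0.
Qed.

Lemma count_gt0_refl (T : eqType) (p : pred T) (s : seq T) x :
  x \in s -> p x -> 0 < (count p s)%:R :> R.
Proof. by move=> xs px; rewrite ltr0n -has_count; apply/hasP; exists x. Qed.

(** Nonnegativity of the conditional mutual information of [f] and [g] given [h]: the termwise bound
    [ln x <= x - 1] reduces it to [submod_sum]. *)
Lemma submod (T A B C : eqType) (f : T -> A) (g : T -> B) (h : T -> C)
    (s : seq T) :
  entropy [seq (f w, g w, h w) | w <- s] + entropy [seq h w | w <- s] <=
  entropy [seq (f w, h w) | w <- s] + entropy [seq (g w, h w) | w <- s].
Proof.
case: (posnP (size s)) => [/size0nil ->|s0]; first by rewrite /= !ent_nil.
rewrite !ent_map -subr_ge0.
set F1 := \sum_(x <- s) _; set F2 := \sum_(x <- s) _.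
set F3 := \sum_(x <- s) _; set F4 := \sum_(x <- s) _.
have -> : (ln (size s)%:R - F1 / (size s)%:R + (ln (size s)%:R - F2 / (size s)%:R)
  - (ln (size s)%:R - F3 / (size s)%:R + (ln (size s)%:R - F4 / (size s)%:R)))
  = (F3 + F4 - F1 - F2) / (size s)%:R by ring.
apply: divr_ge0 => //.
suff : F1 + F2 - F3 - F4 <= 0 by lra.
have := submod_sum f g h s; rewrite -sum1_size natr_sum -subr_le0.
rewrite /F1 /F2 /F3 /F4 -!sumrB -big_split -!sumrB /=.
apply: le_trans; rewrite big_seq [leRHS]big_seq; apply: ler_sum => w ws.
have H (p : pred T) : p w -> 0 < (count p s)%:R :> R by exact: count_gt0_refl.
rewrite (eq_count (a1 := fun y => (f y, h y) == (f w, h w))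
  (a2 := fun v => (f v == f w) && (h v == h w))) //.
rewrite (eq_count (a1 := fun y => (g y, h y) == (g w, h w))
  (a2 := fun v => (g v == g w) && (h v == h w))) //.
rewrite (eq_count (a1 := fun y => (f y, g y, h y) == (f w, g w, h w))
  (a2 := fun v => [&& f v == f w, g v == g w & h v == h w])); last first.
  by move=> v; rewrite !xpair_eqE andbA.
apply: le_trans (ln_le_sub1 _); last first.
  by rewrite divr_gt0 ?mulr_gt0 // H ?eqxx.
by rewrite ln_div ?lnM ?posrE ?mulr_gt0 ?H ?eqxx //; lra.
Qed.

End Entropy.

Section Entropy2.
Variable R : realType.
Notation ent := (entropy R).

Lemma ln_natM (m n : nat) : (0 < m)%N -> (0 < n)%N ->
  ln (m * n)%:R = ln m%:R + ln n%:R :> R.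
Proof. by move=> m0 n0; rewrite natrM lnM ?posrE ?ltr0n. Qed.

Lemma ler_ln_nat (m n : nat) : (m <= n)%N -> ln m%:R <= ln n%:R :> R.
Proof.
case: m => [|m] mn.
  rewrite [leLHS]ln0 //; case: n mn => [|n] _; first by rewrite ln0.
  by rewrite ln_ge0 // ler1n.
by rewrite ler_ln ?ler_nat // posrE ltr0n //; apply: leq_trans mn.
Qed.

Lemma ln_nat_ge0 (n : nat) : 0 <= ln n%:R :> R.
Proof. by have := ler_ln_nat (leq0n n); rewrite ln0. Qed.

Lemma avg_const (T : Type) (s : seq T) (c : R) : (0 < size s)%N ->
  (\sum_(x <- s) c) / (size s)%:R = c.
Proof.
move=> s0; rewrite big_const_seq count_predT iter_addr_0 -[c *+ _]mulr_natr mulfK //.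
by rewrite pnatr_eq0 -lt0n.
Qed.

Lemma le_avg (T : eqType) (s : seq T) (F : T -> R) (c : R) : (0 < size s)%N ->
  {in s, forall x, F x <= c} -> (\sum_(x <- s) F x) / (size s)%:R <= c.
Proof.
move=> s0 Fc; rewrite -[leRHS](avg_const c s0) ler_pM2r ?invr_gt0 ?ltr0n //.
by rewrite big_seq [leRHS]big_seq; apply: ler_sum.
Qed.

Lemma sum1_seq (T : Type) (s : seq T) : \sum_(x <- s) 1 = (size s)%:R :> R.
Proof. by rewrite -sum1_size natr_sum. Qed.

Lemma ent_ge0 (T : eqType) (s : seq T) : 0 <= ent s.
Proof.
case: (posnP (size s)) => [/size0nil ->|s0]; first by rewrite ent_nil.
rewrite /entropy subr_ge0; apply: le_avg => // x xs.
by apply: ler_ln_nat; apply: count_size.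
Qed.

Lemma sum_inv_count (T : eqType) (s : seq T) :
  \sum_(x <- s) (count_mem x s)%:R^-1 = (size (undup s))%:R :> R.
Proof.
rewrite -sum1_size natr_sum -(perm_big _ (perm_count_undup s)) /=.
rewrite big_flatten big_map /= big_seq [RHS]big_seq; apply: eq_bigr => x.
rewrite mem_undup => xs; rewrite big_nseq iter_addr_0 -[_^-1 *+ _]mulr_natr mulVf //.
by rewrite pnatr_eq0 -lt0n -has_count has_pred1.
Qed.

(** Gibbs' inequality: [ln x <= x - 1] is applied with [x = size s / (size t * count)], and the
    inverse counts add up to the number of distinct entries. *)
Lemma ent_le (T : eqType) (s t : seq T) : {subset s <= t} ->
  ent s <= ln (size t)%:R.
Proof.
move=> st.
case: (posnP (size s)) => [/size0nil ->|s0]; first by rewrite ent_nil ln_nat_ge0.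
have ut : (size (undup s) <= size t)%N.
  by apply: uniq_leq_size; [exact: undup_uniq|move=> x; rewrite mem_undup; apply: st].
have t0 : (0 < size t)%N.
  by case: s st s0 {ut} => // x s /(_ x (mem_head _ _)); case: t.
rewrite /entropy lerBlDr -lerBlDl ler_pdivlMr ?ltr0n //.
have -> : (ln (size s)%:R - ln (size t)%:R) * (size s)%:R =
   \sum_(x <- s) (ln (size s)%:R - ln (size t)%:R) :> R.
  by rewrite big_const_seq count_predT iter_addr_0 mulr_natr.
rewrite -subr_ge0 -sumrB.
apply: (@le_trans _ _
  (\sum_(x <- s) (1 - (size s)%:R / (size t)%:R * (count_mem x s)%:R^-1))).
  rewrite sumrB -mulr_sumr sum_inv_count sum1_seq subr_ge0.
  rewrite mulrAC ler_pdivrMr ?ltr0n // ler_wpM2l // ler_nat //.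
rewrite big_seq [leRHS]big_seq; apply: ler_sum => x xs.
have c0 : 0 < (count_mem x s)%:R :> R by exact: (count_gt0_refl R (p := pred1 x) xs (eqxx x)).
have s0' : 0 < (size s)%:R :> R by rewrite ltr0n.
have t0' : 0 < (size t)%:R :> R by rewrite ltr0n.
have := ln_le_sub1 (divr_gt0 (divr_gt0 s0' t0') c0).
by rewrite !ln_div ?posrE ?divr_gt0 //; lra.
Qed.

Lemma count_allpairs (T U : eqType) (s : seq T) (t : seq U) x y :
  count_mem (x, y) [seq (x, y) | x <- s, y <- t] =
  (count_mem x s * count_mem y t)%N.
Proof.
elim: s => [|a s IH] //=; rewrite count_cat IH mulnDl count_map; congr addn.
case: eqP => [->|ax]; first by rewrite mul1n; apply: eq_count => b /=;
  rewrite xpair_eqE eqxx.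
rewrite mul0n; apply/eqP; rewrite -leqn0 leqNgt -has_count; apply/hasPn => b _ /=.
by rewrite xpair_eqE; move/eqP/negbTE: ax => ->.
Qed.

Lemma ent_prod (T U : eqType) (s : seq T) (t : seq U) :
  (0 < size s)%N -> (0 < size t)%N ->
  ent [seq (x, y) | x <- s, y <- t] = ent s + ent t.
Proof.
move=> s0 t0; rewrite /entropy size_allpairs ln_natM //.
have -> : \sum_(z <- [seq (x, y) | x <- s, y <- t])
    ln (count_mem z [seq (x, y) | x <- s, y <- t])%:R =
  (size t)%:R * (\sum_(x <- s) ln (count_mem x s)%:R) +
  (size s)%:R * (\sum_(y <- t) ln (count_mem y t)%:R) :> R.
  rewrite big_allpairs_dep /= mulr_sumr -[in X in _ + X]sum1_size natr_sum mulr_suml.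
  rewrite -big_split big_seq [RHS]big_seq; apply: eq_bigr => x xs /=.
  rewrite mul1r -[in X in X * _]sum1_size natr_sum mulr_suml -big_split /=.
  rewrite big_seq [RHS]big_seq; apply: eq_bigr => y yt.
  by rewrite count_allpairs ln_natM ?mul1r // -has_count has_pred1.
rewrite natrM; field; rewrite !pnatr_eq0; lia.
Qed.

(** Chain rule: averaging over the entries [w] weights each fibre of [g] by its probability, so the
    last term is the conditional entropy of [f] given [g]. *)
Lemma ent_cond (T A B : eqType) (f : T -> A) (g : T -> B) (s : seq T) :
  ent [seq (f w, g w) | w <- s] = ent [seq g w | w <- s] +
  (\sum_(w <- s) ent [seq f v | v <- s & g v == g w]) / (size s)%:R.
Proof.
set S := \sum_(w <- s) ent _.
suff -> : S = \sum_(w <- s) ln (count (fun v => g v == g w) s)%:R -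
   \sum_(w <- s) ln (count (fun v => (f v, g v) == (f w, g w)) s)%:R.
  by rewrite !ent_map; ring.
rewrite {}/S; set N := fun w => count (fun v => g v == g w) s.
pose M w : R := ln (count (fun v => (f v, g v) == (f w, g w)) s)%:R.
rewrite -/(\sum_(w <- s) M w).
have -> : \sum_(w <- s) M w =
    \sum_(v <- s) \sum_(w <- s) (g v == g w)%:R * (M w / (N w)%:R).
  rewrite exchange_big /= big_seq [RHS]big_seq; apply: eq_bigr => w ws.
  rewrite -mulr_suml sumr_count mulrCA divff ?mulr1 //.
  by rewrite gt_eqF // (count_gt0_refl _ ws) ?eqxx.
rewrite -sumrB; apply: eq_bigr => w _.
rewrite ent_map size_filter; congr (_ - _).
rewrite big_filter mulr_suml big_mkcond /=; apply: eq_bigr => v _.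
case: (altP (g v =P g w)) => [gvw|/negbTE gvw]; last first.
  by rewrite eq_sym gvw mul0r.
rewrite gvw eqxx mul1r /M /N gvw; congr (ln _%:R / _).
by rewrite count_filter; apply: eq_count => u /=.
Qed.

Lemma ent_pairr_le (T A B : eqType) (f : T -> A) (g : T -> B) (s : seq T) :
  ent [seq g w | w <- s] <= ent [seq (f w, g w) | w <- s].
Proof.
rewrite ent_cond lerDl divr_ge0 // sumr_ge0 // => w _; exact: ent_ge0.
Qed.

Lemma ent_pairC (T A B : eqType) (f : T -> A) (g : T -> B) (s : seq T) :
  ent [seq (f w, g w) | w <- s] = ent [seq (g w, f w) | w <- s].
Proof. by apply: ent_inj => x y _ _; rewrite !xpair_eqE andbC. Qed.

Lemma ent_pairl_le (T A B : eqType) (f : T -> A) (g : T -> B) (s : seq T) :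
  ent [seq f w | w <- s] <= ent [seq (f w, g w) | w <- s].
Proof. by rewrite ent_pairC ent_pairr_le. Qed.

Lemma ent_cond_le (T A B : eqType) (f : T -> A) (g : T -> B) (s : seq T) K :
  (forall w, w \in s ->
     exists2 t, (size t <= K)%N & {in s, forall v, g v = g w -> f v \in t}) ->
  ent [seq (f w, g w) | w <- s] <= ent [seq g w | w <- s] + ln K%:R.
Proof.
move=> H; case: (posnP (size s)) => [/size0nil ->|s0].
  by rewrite /= !ent_nil add0r ln_nat_ge0.
rewrite ent_cond lerD2l; apply: le_avg => // w /H[t tK Ht].
apply: le_trans (ler_ln_nat tK); apply: ent_le => _ /mapP[v + ->].
by rewrite mem_filter => /andP[/eqP gv vs]; apply: Ht.
Qed.

End Entropy2.

Global Opaque entropy.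

(** * Entropy of sums *)

(** The law of a sum of two independent variables, multiplicities included. *)
Definition addS (V : zmodType) (s t : seq V) : seq V :=
  [seq x + y | x <- s, y <- t].

Lemma allpairsC (A B C : eqType) (F : A -> B -> C) s t :
  perm_eq [seq F x y | x <- s, y <- t] [seq F x y | y <- t, x <- s].
Proof.
elim: s => [|x s IH]; first by rewrite allpairs0r.
by rewrite perm_sym perm_allpairs_consr allpairs_cons perm_cat2l perm_sym.
Qed.

Lemma allpairsA (A B C D : Type) (F : A -> B -> C -> D) s t u :
  [seq F a bc.1 bc.2 | a <- s, bc <- [seq (b, c) | b <- t, c <- u]] =
  [seq F ab.1 ab.2 c | ab <- [seq (a, b) | a <- s, b <- t], c <- u].
Proof.
elim: s => [|x s IH] //.
by rewrite !allpairs_cons allpairs_cat IH map_allpairs allpairs_mapl.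
Qed.

Section AddS.
Variable V : zmodType.
Implicit Types s t u : seq V.

Lemma size_addS s t : size (addS s t) = (size s * size t)%N.
Proof. exact: size_allpairs. Qed.

Lemma addS_catl s1 s2 t : addS (s1 ++ s2) t = addS s1 t ++ addS s2 t.
Proof. exact: allpairs_cat. Qed.

Lemma perm_addS s1 s2 t1 t2 : perm_eq s1 s2 -> perm_eq t1 t2 ->
  perm_eq (addS s1 t1) (addS s2 t2).
Proof. exact: perm_allpairs. Qed.

Lemma addSC s t : perm_eq (addS s t) (addS t s).
Proof.
apply: perm_trans (allpairsC _ _ _) _; 
suff -> : [seq x + y | y <- t, x <- s] = addS t s by exact: perm_refl.
by apply: eq_allpairs => y x; rewrite addrC.
Qed.

Lemma addSA s t u : addS s (addS t u) = addS (addS s t) u.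
Proof.
have -> : addS s (addS t u) =
    [seq a + (bc.1 + bc.2) | a <- s, bc <- [seq (b, c) | b <- t, c <- u]].
  rewrite /addS; elim: s => //= x s ->; congr cat.
  by rewrite !map_allpairs.
rewrite (allpairsA (fun a b c => a + (b + c))).
rewrite /addS -[[seq x + y | x <- s, y <- t]](map_allpairs (fun w => w.1 + w.2) pair).
rewrite allpairs_mapl; congr flatten; apply: eq_map => -[a b] /=.
by apply: eq_map => c; rewrite addrA.
Qed.

Lemma addS0 s : addS s [:: 0] = s.
Proof. by rewrite /addS allpairs1r; under eq_map do rewrite addr0; rewrite map_id. Qed.

End AddS.

Section EntAddS.
Variable R : realType.
Variable V : zmodType.
Notation ent := (entropy R).
Implicit Types s t u : seq V.

Lemma ent_addSE s t :
  ent (addS s t) = ent [seq w.1 + w.2 | w <- [seq (x, y) | x <- s, y <- t]].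
Proof. by rewrite map_allpairs. Qed.

Lemma ent_map_fst (A B C : eqType) (f : A -> C) (s : seq A) (t : seq B) :
  (0 < size t)%N ->
  ent [seq f w.1 | w <- [seq (x, y) | x <- s, y <- t]] = ent [seq f x | x <- s].
Proof.
move=> t0; have cnt (p : pred A) :
    count (fun w => p w.1) [seq (x, y) | x <- s, y <- t] = (count p s * size t)%N.
  elim: s => //= x s IH; rewrite count_cat IH mulnDl count_map; congr addn.
  case px: (p x); rewrite ?mul1n ?mul0n.
    by rewrite -(count_predT t); apply: eq_count => y /=.
  by rewrite -(count_pred0 t); apply: eq_count => y /=.
case: (posnP (size s)) => [/size0nil ->|s0]; first by [].
rewrite !ent_map size_allpairs ln_natM // big_allpairs_dep /=.
have -> : \sum_(x <- s) \sum_(y <- t)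
    ln (count (fun w => f w.1 == f x) [seq (x, y) | x <- s, y <- t])%:R =
    (size t)%:R * \sum_(x <- s) (ln (count (fun y => f y == f x) s)%:R + ln (size t)%:R) :> R.
  rewrite mulr_sumr big_seq [RHS]big_seq; apply: eq_bigr => x xs.
  rewrite -[X in X * _](sum1_seq R) mulr_suml; apply: eq_bigr => y _.
  rewrite mul1r (cnt (fun v => f v == f x)) ln_natM //.
  by rewrite -has_count; apply/hasP; exists x.
rewrite big_split /= natrM mulrDr.
have -> : \sum_(x <- s) ln (size t)%:R = (size s)%:R * ln (size t)%:R :> R.
  by rewrite -[X in X * _](sum1_seq R) mulr_suml; apply: eq_bigr => x _; rewrite mul1r.
by field; rewrite !pnatr_eq0; lia.
Qed.

Lemma ent_map_snd (A B C : eqType) (f : B -> C) (s : seq A) (t : seq B) :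
  (0 < size s)%N ->
  ent [seq f w.2 | w <- [seq (x, y) | x <- s, y <- t]] = ent [seq f x | x <- t].
Proof.
move=> s0; rewrite -(ent_map_fst f t s0).
have -> : [seq f w.2 | w <- [seq (x, y) | x <- s, y <- t]] = [seq f y | x <- s, y <- t].
  by rewrite map_allpairs.
by rewrite map_allpairs; apply: ent_perm; apply: allpairsC.
Qed.

(* The Kaimanovich-Vershik inequality: submodularity for the variables [a],
   [c] and [a + b + c] when [a], [b], [c] are independent. *)
Lemma ent_addS_submod s t u : (0 < size s)%N -> (0 < size t)%N -> (0 < size u)%N ->
  ent (addS (addS s t) u) + ent t <= ent (addS s t) + ent (addS t u).
Proof.
move=> s0 t0 u0.
set W := [seq (a, bc) | a <- s, bc <- [seq (b, c) | b <- t, c <- u]].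
have W2 (D : eqType) (F : V -> V -> V -> D) :
    [seq F w.1 w.2.1 w.2.2 | w <- W] =
    [seq F ab.1 ab.2 c | ab <- [seq (a, b) | a <- s, b <- t], c <- u].
  by rewrite -(allpairsA F) map_allpairs.
have := submod R (fun w => w.1) (fun w => w.2.2) (fun w => w.1 + w.2.1 + w.2.2) W.
have -> : ent [seq w.1 + w.2.1 + w.2.2 | w <- W] = ent (addS (addS s t) u).
  rewrite (W2 _ (fun a b c => a + b + c)) /addS.
  rewrite -[[seq x + y | x <- s, y <- t]](map_allpairs (fun w => w.1 + w.2) pair).
  by rewrite allpairs_mapl.
have -> : ent [seq (w.1, w.2.2, w.1 + w.2.1 + w.2.2) | w <- W] =
    ent s + (ent t + ent u).
  rewrite -(ent_prod R t0 u0) -ent_prod ?size_allpairs ?muln_gt0 ?t0 //.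
  rewrite -/W -[in RHS](map_id W); apply: ent_inj => -[a [b c]] [a' [b' c']] _ _ /=.
  apply/eqP/eqP => [[-> -> /eqP]|[-> -> ->]//].
  by rewrite (inj_eq (addIr _)) (inj_eq (addrI _)) => /eqP ->.
have -> : ent [seq (w.1, w.1 + w.2.1 + w.2.2) | w <- W] = ent s + ent (addS t u).
  rewrite -ent_prod ?size_addS ?muln_gt0 ?t0 //.
  rewrite -[addS t u](map_allpairs (fun w => w.1 + w.2) pair).
  rewrite (allpairs_mapr pair (fun _ w => w.1 + w.2)).
  rewrite -(map_allpairs (fun w => (w.1, w.2.1 + w.2.2)) pair) -/W.
  apply: ent_inj => -[a [b c]] [a' [b' c']] _ _ /=.
  rewrite !xpair_eqE; case: eqP => //= ->.
  by rewrite -!addrA (inj_eq (addrI _)).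
have -> : ent [seq (w.2.2, w.1 + w.2.1 + w.2.2) | w <- W] = ent (addS s t) + ent u.
  rewrite -ent_prod ?size_addS ?muln_gt0 ?s0 //.
  have -> : [seq (x, y) | x <- addS s t, y <- u] = [seq (w.1 + w.2.1, w.2.2) | w <- W].
    rewrite (W2 _ (fun a b c => (a + b, c))) /addS.
    rewrite -[[seq x + y | x <- s, y <- t]](map_allpairs (fun w => w.1 + w.2) pair).
    by rewrite allpairs_mapl.
  apply: ent_inj => -[a [b c]] [a' [b' c']] _ _ /=.
  rewrite !xpair_eqE; case: (c =P c') => [->|]; rewrite ?andbF //= !andbT.
  by rewrite (inj_eq (addIr _)).
lra.
Qed.

Lemma ent_seq1 (T : eqType) (x : T) : ent [:: x] = 0.
Proof. by rewrite ent_uniq // ln1. Qed.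

Lemma ent_addS_le s t : (0 < size s)%N -> (0 < size t)%N ->
  ent (addS s t) <= ent s + ent t.
Proof.
move=> s0 t0; have := @ent_addS_submod s [:: 0] t s0 isT t0.
rewrite addS0 ent_seq1 addr0 (ent_perm R (addSC [:: 0] t)) addS0; lra.
Qed.

(** Submodularity with trivial conditioning for [a + b] and [b], whose joint entropy is
    [ent s + ent t]. *)
Lemma ent_addS_ge s t : (0 < size s)%N -> (0 < size t)%N ->
  ent s <= ent (addS s t).
Proof.
move=> s0 t0; set W := [seq (x, y) | x <- s, y <- t].
have := submod R (fun w => w.1 + w.2) (fun w => w.2) (fun=> 0 : V) W.
have -> : ent [seq (0 : V) | _ <- W] = 0.
  apply/eqP; rewrite eq_le ent_ge0 andbT.
  have /(ent_le R) /le_trans : {subset [seq (0 : V) | _ <- W] <= [:: 0]}.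
    by move=> _ /mapP[? _ ->]; rewrite inE.
  by apply; rewrite ln1.
have -> : ent [seq (w.1 + w.2, w.2, 0 : V) | w <- W] = ent s + ent t.
  rewrite -ent_prod // -/W -[in RHS](map_id W); apply: ent_inj => -[a b] [a' b'] _ _ /=.
  apply/eqP/eqP => [[/eqP + e]|[-> ->]//].
  by rewrite e (inj_eq (addIr _)) => /eqP ->.
have -> : ent [seq (w.1 + w.2, 0 : V) | w <- W] = ent (addS s t).
  rewrite ent_addSE; apply: ent_inj => w w' _ _.
  by rewrite xpair_eqE eqxx andbT.
have -> : ent [seq (w.2, 0 : V) | w <- W] = ent t.
  rewrite -[in RHS](map_id t) -(ent_map_snd id t s0); apply: ent_inj => w w' _ _.
  by rewrite xpair_eqE eqxx andbT.
lra.
Qed.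

Definition entropy_gain s t := ent (addS s t) - ent s.
Notation gain := entropy_gain.

(** The Kaimanovich-Vershik inequality as it is applied below: the larger the sum already present,
    the less a new summand adds. *)
Lemma gain_addS_le s t u : (0 < size s)%N -> (0 < size t)%N -> (0 < size u)%N ->
  gain (addS s t) u <= gain t u.
Proof. by move=> s0 t0 u0; have := ent_addS_submod s0 t0 u0; rewrite /gain; lra. Qed.

(** Convexity of the gain in the law of its first argument. Submodularity for the label and the
    summand [c], given [X + c], says that conditioning on the label can only raise the gain. *)
Lemma gain_label (T A : eqType) (X : T -> V) (f : T -> A) (s : seq T) t :
  (0 < size s)%N -> (0 < size t)%N ->
  gain [seq X w | w <- s] t <=
  (\sum_(w <- s) gain [seq X v | v <- s & f v == f w] t) / (size s)%:R.
Proof.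
move=> s0 t0; set W := [seq (w, c) | w <- s, c <- t].
have := submod R (fun w => f w.1) (fun w => w.2) (fun w => X w.1 + w.2) W.
have -> : ent [seq X w.1 + w.2 | w <- W] = ent (addS [seq X w | w <- s] t).
  by rewrite map_allpairs /addS allpairs_mapl.
have -> : ent [seq (f w.1, w.2, X w.1 + w.2) | w <- W] =
    ent [seq (X w, f w) | w <- s] + ent t.
  rewrite -ent_prod ?size_map // allpairs_mapl.
  rewrite -(map_allpairs (fun w => ((X w.1, f w.1), w.2)) pair) -/W.
  apply: ent_inj => -[a b] [a' b'] _ _ /=.
  apply/eqP/eqP => [[-> /eqP + e]|[-> -> ->]//].
  by move=> /eqP bb; move: e; rewrite bb => /addIr ->.
have -> : ent [seq (w.2, X w.1 + w.2) | w <- W] = ent [seq X w | w <- s] + ent t.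
  rewrite -ent_prod ?size_map // allpairs_mapl.
  rewrite -(map_allpairs (fun w => (X w.1, w.2)) pair) -/W.
  apply: ent_inj => -[a b] [a' b'] _ _ /=.
  apply/eqP/eqP => [[bb e]|[-> ->]//].
  by move: e; rewrite bb => /addIr ->.
rewrite (ent_pairC R (fun w => f w.1)) !ent_cond.
have -> : ent [seq f w.1 | w <- W] = ent [seq f w | w <- s] by rewrite ent_map_fst.
have -> : (\sum_(w <- W) ent [seq X v.1 + v.2 | v <- W & f v.1 == f w.1]) / (size W)%:R =
   (\sum_(w <- s) ent (addS [seq X v | v <- s & f v == f w] t)) / (size s)%:R.
  have fW w : [seq X v.1 + v.2 | v <- W & f v.1 == f w] =
      addS [seq X v | v <- s & f v == f w] t.
    rewrite /W /addS; elim: (s) => //= x s' IH; rewrite filter_cat map_cat IH.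
    rewrite filter_map /=; case: ifP => fx /=.
      by rewrite (eq_filter (a2 := predT)) ?filter_predT // -map_comp.
    by rewrite (eq_filter (a2 := pred0)) ?filter_pred0.
  rewrite big_allpairs_dep /= size_allpairs.
  under eq_bigr => w _.
    under eq_bigr => y _ do rewrite fW.
    rewrite -[X in \sum_(y <- t) X]mul1r -mulr_suml sum1_seq.
    over.
  rewrite -mulr_sumr natrM; field; rewrite !pnatr_eq0; lia.
rewrite /gain [X in _ -> _ <= X / _]sumrB mulrBl; lra.
Qed.

Lemma gain_cat s1 s2 t : (0 < size t)%N ->
  (size (s1 ++ s2))%:R * gain (s1 ++ s2) t <=
  (size s1)%:R * gain s1 t + (size s2)%:R * gain s2 t.
Proof.
move=> t0.
case: (posnP (size (s1 ++ s2))) => [/eqP|s0].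
  by rewrite size_cat addn_eq0 => /andP[/eqP/size0nil -> /eqP/size0nil ->];
    rewrite /= !mul0r addr0.
set s := [seq (true, x) | x <- s1] ++ [seq (false, x) | x <- s2].
have ss : [seq w.2 | w <- s] = s1 ++ s2 by rewrite map_cat -!map_comp !map_id.
have sz : size s = size (s1 ++ s2) by rewrite -ss size_map.
have := @gain_label _ _ (fun w => w.2) (fun w => w.1) s t.
rewrite sz ss => /(_ s0 t0); rewrite ler_pdivlMr ?ltr0n // mulrC => /le_trans; apply.
have fil b c (u : seq V) : [seq v.2 | v <- [seq (c, x) | x <- u] & v.1 == b] =
    if b == c then u else [::].
  rewrite filter_map -map_comp; case: (altP (b =P c)) => [->|bc].
    by rewrite (eq_in_filter (a2 := predT)) ?filter_predT ?map_id // => x _ /=;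
      rewrite eqxx.
  rewrite (eq_in_filter (a2 := pred0)) ?filter_pred0 // => x _ /=.
  by rewrite eq_sym (negbTE bc).
have f1 : [seq v.2 | v <- s & v.1 == true] = s1.
  by rewrite filter_cat map_cat !fil cats0.
have f2 : [seq v.2 | v <- s & v.1 == false] = s2.
  by rewrite filter_cat map_cat !fil.
rewrite big_cat !big_map /= f1 f2.
by rewrite !big_const_seq !count_predT !iter_addr_0 !mulr_natl.
Qed.

End EntAddS.

(** * Entropy at a scale *)

Definition ints_below (k : nat) : seq int := [seq Posz i | i <- iota 0 k].

Definition dil (c : nat) (s : seq int) : seq int := [seq c%:Z * x | x <- s].

Lemma size_U k : size (ints_below k) = k.
Proof. by rewrite size_map size_iota. Qed.

Lemma size_dil c s : size (dil c s) = size s.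
Proof. exact: size_map. Qed.

Lemma mem_U k (x : int) : (x \in ints_below k) = (0 <= x < k%:Z).
Proof.
apply/mapP/idP => [[i]|]; first by rewrite mem_iota => /andP[_ ik] ->; lia.
by case: x => // i ik; exists i => //; rewrite mem_iota; lia.
Qed.

Lemma uniq_U k : uniq (ints_below k).
Proof. by rewrite map_inj_uniq ?iota_uniq // => x y []. Qed.

Lemma dil_addS c s t : dil c (addS s t) = addS (dil c s) (dil c t).
Proof.
rewrite /dil /addS map_allpairs allpairs_mapl allpairs_mapr.
by apply: eq_allpairs => x y; rewrite mulrDr.
Qed.

Lemma dil_dil a b s : dil a (dil b s) = dil (a * b) s.
Proof. by rewrite /dil -map_comp; apply: eq_map => x /=; rewrite mulrA PoszM. Qed.

Lemma dil1 s : dil 1 s = s.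
Proof. by rewrite /dil -[RHS]map_id; apply: eq_map => x; rewrite mul1r. Qed.

Lemma perm_dil c s t : perm_eq s t -> perm_eq (dil c s) (dil c t).
Proof. exact: perm_map. Qed.

Lemma uniq_addS_dil c s : (0 < c)%N -> uniq s -> uniq (addS (dil c s) (ints_below c)).
Proof.
move=> c0 us; rewrite /addS /dil allpairs_mapl; apply: allpairs_uniq => //.
  exact: uniq_U.
move=> [x i] [y j] /allpairsP[[x1 i1] [/= _ + [-> ->]]] /allpairsP[[y1 j1] [/= _ + [-> ->]]].
rewrite !mem_U /= => hi hj e.
have xy : x1 = y1 by nia.
by move: e; rewrite xy => /addrI ->.
Qed.

(** Division with remainder: a uniform variable below [c * k] is an independent sum of a coarse and
    a fine one. This turns a change of scale into the addition of a summand. *)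
Lemma U_mul c k : (0 < c)%N -> perm_eq (ints_below (c * k)) (addS (dil c (ints_below k)) (ints_below c)).
Proof.
move=> c0; apply: uniq_perm; [exact: uniq_U|by rewrite uniq_addS_dil ?uniq_U|].
move=> x; rewrite mem_U; apply/idP/allpairsP => [xk|[[_ i] [/= /mapP[j + ->]]]].
  exists (c%:Z * (x %/ c)%Z, (x %% c)%Z); split => /=.
  - apply/mapP; exists (x %/ c)%Z => //; rewrite mem_U.
    have := divz_eq x c; have := ltz_pmod x (d := c); have := modz_ge0 x (d := c); nia.
  - rewrite mem_U; have := ltz_pmod x (d := c); have := modz_ge0 x (d := c); lia.
  - by rewrite {1}(divz_eq x c) mulrC.
rewrite !mem_U => hj hi ->; nia.
Qed.

Section Lam.
Variable R : realType.
Notation ent := (entropy R).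
Notation gain := (entropy_gain R).
Implicit Types (s t : seq int) (k c Q : nat).

(* Smoothing by an independent uniform variable in [[0, k)] stands for the
   entropy of the partition into cells of length [k], and makes the estimates
   translation invariant and exactly submodular. *)
Definition scale_entropy s k : R := ent (addS s (ints_below k)) - ln k%:R.
Notation lam := scale_entropy.

Lemma ent_U k : ent (ints_below k) = ln k%:R.
Proof. by rewrite ent_uniq ?uniq_U // size_U. Qed.

Lemma ent_dil c s : (0 < c)%N -> ent (dil c s) = ent s.
Proof. by move=> c0; apply: ent_inj1 => x y _ _; nia. Qed.

Lemma lam_perm s t k : perm_eq s t -> lam s k = lam t k.
Proof. by move=> e; rewrite /lam (ent_perm R (perm_addS e (perm_refl (ints_below k)))). Qed.

Lemma ent_addSC s t : ent (addS s t) = ent (addS t s).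
Proof. exact: ent_perm (addSC s t). Qed.

Lemma addS_gt0 s t : (0 < size s)%N -> (0 < size t)%N -> (0 < size (addS s t))%N.
Proof. by move=> *; rewrite size_addS muln_gt0; apply/andP. Qed.

Lemma lam_ge0 s k : (0 < size s)%N -> (0 < k)%N -> 0 <= lam s k.
Proof.
move=> s0 k0; rewrite subr_ge0 -ent_U ent_addSC; apply: ent_addS_ge => //.
by rewrite size_U.
Qed.

Lemma lam_le_ent s k : (0 < size s)%N -> (0 < k)%N -> lam s k <= ent s.
Proof.
move=> s0 k0; have := ent_addS_le R s0 (t := ints_below k); rewrite size_U => /(_ k0).
rewrite ent_U /lam; lra.
Qed.

Lemma lam_addl s t k : (0 < size s)%N -> (0 < size t)%N -> (0 < k)%N ->
  lam t k <= lam (addS s t) k.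
Proof.
move=> s0 t0 k0; rewrite /lam lerD2r -addSA [leRHS]ent_addSC ent_addS_ge //.
by rewrite addS_gt0 ?size_U.
Qed.

Lemma lam_addr s t k : (0 < size s)%N -> (0 < size t)%N -> (0 < k)%N ->
  lam t k <= lam (addS t s) k.
Proof. by move=> *; rewrite (lam_perm _ (addSC _ _)) lam_addl. Qed.

Lemma ent_interval s (a : int) d : {in s, forall x, a <= x < a + d%:Z} ->
  ent s <= ln d%:R.
Proof.
move=> H; have -> : d = size [seq a + i | i <- ints_below d] by rewrite size_map size_U.
apply: ent_le => x xs; apply/mapP; exists (x - a); last by lia.
by rewrite mem_U; have := H x xs; lia.
Qed.

Lemma lam_interval s (a : int) d k : (0 < k)%N ->
  {in s, forall x, a <= x < a + d%:Z} -> lam s k <= ln (d + k)%:R - ln k%:R.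
Proof.
move=> k0 H; rewrite /lam lerD2r; apply: (ent_interval (a := a)).
by move=> _ /allpairsP[[x i] [/= /H + + ->]]; rewrite mem_U; lia.
Qed.

Lemma gain_U k K : (0 < k)%N -> (0 < K)%N ->
  gain (ints_below k) (ints_below K) <= ln (k + K)%:R - ln k%:R.
Proof.
move=> k0 K0; rewrite /entropy_gain ent_U lerD2r; apply: (ent_interval (a := 0)).
by move=> _ /allpairsP[[x i] [/= + + ->]]; rewrite !mem_U; lia.
Qed.

Lemma gain_addS_U s k K : (0 < size s)%N -> (0 < k)%N -> (0 < K)%N ->
  gain (addS s (ints_below k)) (ints_below K) <= ln (k + K)%:R - ln k%:R.
Proof.
move=> s0 k0 K0; apply: (le_trans _ (gain_U k0 K0)).
by apply: gain_addS_le; rewrite ?size_U.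
Qed.

Lemma addS_UC s k K : perm_eq (addS (addS s (ints_below k)) (ints_below K)) (addS (addS s (ints_below K)) (ints_below k)).
Proof. by rewrite -!addSA; apply: perm_addS => //; apply: addSC. Qed.

(** The loss pays for scales of which neither divides the other: after smoothing by both intervals,
    in either order, the gain of the longer one is at most [ln ((k + K) / k) <= ln (2 K / k)]. *)
Lemma lam_scale_le s k K : (0 < size s)%N -> (0 < k)%N -> (k <= K)%N ->
  lam s K <= lam s k + ln 2%:R.
Proof.
move=> s0 k0 kK; have K0 : (0 < K)%N by lia.
have h1 : ent (addS s (ints_below K)) <= ent (addS (addS s (ints_below K)) (ints_below k)).
  by apply: ent_addS_ge; rewrite ?addS_gt0 ?size_U.
have := gain_addS_U s0 k0 K0; rewrite /entropy_gain -(ent_perm R (addS_UC _ _ _)).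
have : ln (k + K)%:R <= ln (2 * K)%:R :> R by apply: ler_ln_nat; lia.
rewrite ln_natM // /lam; lra.
Qed.

(** This is [gain_addS_le] for the summand [ints_below K]. The loss [ln 2] again comes from
    arbitrary scales; between a scale and a multiple of it, [inc_addS] has none. *)
Lemma lam_diff_addS s t k K : (0 < size s)%N -> (0 < size t)%N -> (0 < k)%N ->
  (k <= K)%N ->
  lam t k - lam t K <= lam (addS s t) k - lam (addS s t) K + ln 2%:R.
Proof.
move=> s0 t0 k0 kK; have K0 : (0 < K)%N by lia.
have := @gain_addS_le R _ s (addS t (ints_below k)) (ints_below K) s0.
rewrite addS_gt0 ?size_U // => /(_ isT K0); rewrite addSA /entropy_gain.
have h1 : ent (addS (addS s t) (ints_below K)) <= ent (addS (addS (addS s t) (ints_below k)) (ints_below K)).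
  rewrite (ent_perm R (addS_UC _ _ _)).
  by apply: ent_addS_ge; rewrite ?addS_gt0 ?size_U.
have := gain_addS_U t0 K0 k0; rewrite /entropy_gain -(ent_perm R (addS_UC _ _ _)).
have : ln (K + k)%:R <= ln (2 * K)%:R :> R by apply: ler_ln_nat; lia.
rewrite ln_natM // /lam; lra.
Qed.

Definition scale_increment s k Q : R := lam s k - lam s (k * Q).
Notation inc := scale_increment.

(** An increment is the shortfall of a gain from [ln Q], because smoothing at scale [k * Q] is
    smoothing at scale [k] followed by adding [k] times a uniform variable below [Q]. Bounds on
    gains thus become bounds on increments with the sign reversed: monotonicity under addition in
    [inc_addS], concavity in [inc_cat]. *)
Lemma incE s k Q : (0 < k)%N -> (0 < Q)%N ->
  inc s k Q = ln Q%:R - gain (addS s (ints_below k)) (dil k (ints_below Q)).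
Proof.
move=> k0 Q0; rewrite /inc /lam /entropy_gain ln_natM //.
have -> : ent (addS s (ints_below (k * Q))) = ent (addS (addS s (ints_below k)) (dil k (ints_below Q))).
  apply: ent_perm; rewrite -addSA; apply: perm_addS => //.
  exact: perm_trans (U_mul _ k0) (addSC _ _).
lra.
Qed.

Lemma inc_ge0 s k Q : (0 < size s)%N -> (0 < k)%N -> (0 < Q)%N -> 0 <= inc s k Q.
Proof.
move=> s0 k0 Q0; rewrite incE // subr_ge0 /entropy_gain.
have := @ent_addS_le R _ (addS s (ints_below k)) (dil k (ints_below Q)).
rewrite addS_gt0 ?size_dil ?size_U // => /(_ isT Q0).
rewrite ent_dil // ent_U; lra.
Qed.

Lemma inc_addS s t k Q : (0 < size s)%N -> (0 < size t)%N -> (0 < k)%N ->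
  (0 < Q)%N -> inc t k Q <= inc (addS s t) k Q.
Proof.
move=> s0 t0 k0 Q0; rewrite !incE // lerD2l lerN2 -addSA.
by apply: gain_addS_le; rewrite ?addS_gt0 ?size_dil ?size_U.
Qed.

Lemma inc_perm s t k Q : perm_eq s t -> inc s k Q = inc t k Q.
Proof. by move=> e; rewrite /inc !(lam_perm _ e). Qed.

Lemma inc_cat s t k Q : (0 < k)%N -> (0 < Q)%N ->
  (size s)%:R * inc s k Q + (size t)%:R * inc t k Q <=
  (size (s ++ t))%:R * inc (s ++ t) k Q.
Proof.
move=> k0 Q0; rewrite !incE // addS_catl.
have := gain_cat R (addS s (ints_below k)) (addS t (ints_below k)) (t := dil k (ints_below Q)).
rewrite size_dil size_U => /(_ Q0).
rewrite !size_cat !size_addS size_U -mulnDl !natrM natrD.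
set a := (size s)%:R; set b := (size t)%:R; set G := entropy_gain _ _ _.
set G1 := entropy_gain _ _ _; set G2 := entropy_gain _ _ _.
have -> : (a + b) * k%:R * G = k%:R * ((a + b) * G) by ring.
have -> : a * k%:R * G1 + b * k%:R * G2 = k%:R * (a * G1 + b * G2) by ring.
rewrite ler_pM2l ?ltr0n //; lra.
Qed.

Lemma inc_flatten (ss : seq (seq int)) k Q : (0 < k)%N -> (0 < Q)%N ->
  \sum_(s <- ss) (size s)%:R * inc s k Q <=
  (size (flatten ss))%:R * inc (flatten ss) k Q.
Proof.
move=> k0 Q0; elim: ss => [|s ss IH]; first by rewrite big_nil mul0r.
rewrite big_cons /=; apply: (le_trans _ (inc_cat _ _ k0 Q0)); lra.
Qed.

(** A multiple of [c] can be read off from its sum with a variable below [c], so the fine summand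
    contributes exactly [ln c]. *)
Lemma lam_dil c s k : (0 < c)%N -> (0 < size s)%N -> (0 < k)%N ->
  lam (dil c s) (c * k) = lam s k.
Proof.
move=> c0 s0 k0; rewrite /lam ln_natM //.
suff -> : ent (addS (dil c s) (ints_below (c * k))) = ent (addS s (ints_below k)) + ln c%:R by lra.
have -> : ent (addS (dil c s) (ints_below (c * k))) = ent (addS (dil c (addS s (ints_below k))) (ints_below c)).
  apply: ent_perm; rewrite dil_addS -addSA; apply: perm_addS => //.
  exact: U_mul.
rewrite -ent_U -ent_prod ?size_U ?addS_gt0 ?size_U //.
rewrite ent_addSE /dil allpairs_mapl.
set W := [seq (x, y) | x <- addS s (ints_below k), y <- ints_below c].
rewrite -(map_allpairs (fun w : int * int => (c%:Z * w.1, w.2)) pair) -/W -map_comp.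
apply: ent_inj1 => -[x i] [y j] /allpairsP[[x1 i1] [/= _ + [-> ->]]].
move=> + /allpairsP[[y1 j1] [/= _ + [-> ->]]].
rewrite !mem_U /= => hi hj e.
have xy : x1 = y1 by nia.
by move: e; rewrite xy => /addrI ->.
Qed.

Lemma inc_dil c s k Q : (0 < c)%N -> (0 < size s)%N -> (0 < k)%N -> (0 < Q)%N ->
  inc (dil c s) (c * k) Q = inc s k Q.
Proof.
by move=> c0 s0 k0 Q0; rewrite /inc -mulnA !lam_dil // muln_gt0 k0.
Qed.

Lemma lam_sep s k : (0 < size s)%N -> (0 < k)%N -> uniq s ->
  {in s &, forall x y, x < y -> k%:Z <= y - x} -> lam s k = ln (size s)%:R.
Proof.
move=> s0 k0 us sep; rewrite /lam.
rewrite ent_uniq ?size_addS ?size_U ?ln_natM //; first by lra.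
apply: allpairs_uniq => //; first exact: uniq_U.
move=> [x i] [y j] /allpairsP[[x1 i1] [/= x1s + [-> ->]]].
move=> + /allpairsP[[y1 j1] [/= y1s + [-> ->]]].
rewrite !mem_U /= => hi hj e.
have xy : x1 = y1.
  case: (ltgtP x1 y1) => // xy; first by have := sep _ _ x1s y1s xy; lia.
  by have := sep _ _ y1s x1s xy; lia.
by move: e; rewrite xy => /addrI ->.
Qed.

End Lam.

(** The sequence [u n - C] is superadditive, and [alpha] is the supremum of [(u n - C) / n]. The
    loss of slope [e] and the constant [K] are the price for a lower bound valid at every [n]. *)
Lemma fekete (R : realType) (u : nat -> R) (C L : R) :
  (forall n, 0 <= u n) -> (forall n, u n <= L * n%:R) -> 0 <= C ->
  (forall i j, u i + u j - C <= u (i + j)%N) ->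
  exists alpha : R, [/\ 0 <= alpha, forall n, u n <= alpha * n%:R + C &
    forall e : R, 0 < e ->
      exists2 K : R, 0 <= K & forall n, (alpha - e) * n%:R - K <= u n].
Proof.
move=> u0 uL C0 uD; pose E : set R := ([set x | exists2 n, (0 < n)%N & x = (u n - C) / n%:R])%classic.
have Esup : has_sup E.
  split; first by exists ((u 1%N - C) / 1%:R); exists 1%N.
  exists L => _ [n n0 ->]; rewrite ler_pdivrMr ?ltr0n //.
  by have := uL n; lra.
have uk N k r : k%:R * (u N - C) + u r <= u (k * N + r)%N.
  elim: k => [|k IH]; first by rewrite mul0r add0r.
  have := uD N (k * N + r)%N; rewrite addnA -mulSn -natr1 mulrDl mul1r; lra.
have upper n : u n <= sup E * n%:R + C.
  case: (posnP n) => [->|n0]; first by have := uL 0%N; rewrite !mulr0 add0r; lra.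
  rewrite -lerBlDr -ler_pdivrMr ?ltr0n //.
  by apply: ub_le_sup; [exact: Esup.2|exists n].
exists (sup E); split => //.
  (* A negative supremum would push the upper bound below 0 for large [n]. *)
  rewrite leNgt; apply/negP => s0.
  pose n := (Num.truncn ((C + 1) / - sup E)).+1.
  have : (C + 1) / - sup E < n%:R by rewrite truncnS_gt.
  rewrite ltr_pdivrMr; last by lra.
  by have := upper n; have := u0 n; nra.
(* [N] nearly attains the supremum; [n] is divided by [N], and [K] absorbs the remainder. *)
move=> e e0; have [x [N N0 ->] hx] := sup_adherent e0 Esup.
have {}hx : (sup E - e) * N%:R <= u N - C.
  by rewrite -ler_pdivlMr ?ltr0n // ltW.
exists (N%:R * `|sup E - e|); first by rewrite mulr_ge0.
move=> n; rewrite (divn_eq n N); apply: (le_trans _ (uk N _ _)).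
have rN : (n %% N)%:R <= N%:R :> R by rewrite ler_nat ltnW ?ltn_pmod.
have := u0 (n %% N)%N; rewrite natrD natrM.
have := ler_wpM2l (ler0n R (n %/ N)) hx.
have := ler_norm (sup E - e); have := normr_ge0 (sup E - e).
have : 0 <= (n %% N)%:R :> R by [].
nra.
Qed.

(** * Growth rate of the cylinder entropies *)

Section Cylinders.
Variable R : realType.
Variables (p q M : nat) (D : seq int).
Hypotheses (p0 : (0 < p)%N) (pq : (p < q)%N).
Hypotheses (D0 : (0 < size D)%N) (DM : {in D, forall d, `|d| <= M%:Z}).
Notation ent := (entropy R).
Notation lam := (scale_entropy R).
Notation inc := (scale_increment R).

(* Over the words [w] of length [n], these are the numerators of [f_w(0)] for the
   denominator [q ^ (n - 1)], so that length [r ^ n] becomes length about [p ^ n]. *)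
Fixpoint cylinder_sums (n : nat) : seq int :=
  if n is n'.+1 then addS (dil q (cylinder_sums n')) (dil (p ^ n') D) else [:: 0].
Notation S := cylinder_sums.

Lemma size_S n : size (S n) = (size D ^ n)%N.
Proof. by elim: n => //= n IH; rewrite size_addS !size_dil IH expnSr. Qed.

Lemma S_gt0 n : (0 < size (S n))%N.
Proof. by rewrite size_S expn_gt0 D0. Qed.

Lemma pX_gt0 n : (0 < p ^ n)%N. Proof. by rewrite expn_gt0 p0. Qed.

Lemma qX_gt0 n : (0 < q ^ n)%N. Proof. by rewrite expn_gt0; lia. Qed.

Lemma pqX n : (p ^ n <= q ^ n)%N.
Proof. by case: n => // n; rewrite leq_exp2r // ltnW. Qed.

(** A word of length [i + j] is a concatenation; on the common denominator its first part is
    multiplied by [q^j] and its second by [p^i]. *)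
Lemma S_add i j : perm_eq (S (i + j)) (addS (dil (q ^ j) (S i)) (dil (p ^ i) (S j))).
Proof.
elim: j => [|j IH].
  by rewrite addn0 expn0 dil1 /= /dil /= mulr0 addS0.
rewrite addnS /= dil_addS !dil_dil -expnD addSA.
apply: perm_addS => //; apply: (perm_trans (perm_dil q IH)).
by rewrite dil_addS !dil_dil -expnS (mulnC q).
Qed.

Lemma S_interval n :
  {in S n, forall x, - (M * q ^ n)%N%:Z <= x < - (M * q ^ n)%N%:Z + (2 * M * q ^ n + 1)%N%:Z}.
Proof.
(* The term [M p^n] strengthens the induction, which closes because [p + 1 <= q] gives
   [q M p^n >= M p^n + M p^(n+1)]. *)
suff H x : x \in S n -> `|x| + (M * p ^ n)%N%:Z <= (M * q ^ n)%N%:Z.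
  by move=> x /H; lia.
elim: n x => [|n IH] x; first by rewrite inE => /eqP ->; rewrite normr0 !expn0 add0r.
move=> /allpairsP[[y z] [/= /mapP[y' /IH hy ->] /mapP[d /DM hd ->] ->]].
rewrite !expnS; move: (q ^ n)%N (p ^ n)%N hy hd => a b hy hd.
have h1 : `|q%:Z * y' + b%:Z * d| <= q%:Z * `|y'| + b%:Z * `|d|.
  by apply: (le_trans (ler_normD _ _)); rewrite !normrM.
have h2 : b%:Z * `|d| <= b%:Z * M%:Z by apply: ler_wpM2l.
have h3 : q%:Z * (`|y'| + (M * b)%N%:Z) <= q%:Z * (M * a)%N%:Z by apply: ler_wpM2l.
have h4 : (M * b * p.+1 <= M * b * q)%N by rewrite leq_mul2l pq orbT.
lia.
Qed.

Definition cylinder_entropy n : R := lam (S n) (p ^ n).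
Notation h := cylinder_entropy.

Lemma h_ge0 n : 0 <= h n.
Proof. by rewrite lam_ge0 ?S_gt0 ?pX_gt0. Qed.

Lemma ent_S_le n : ent (S n) <= ln (size D)%:R * n%:R.
Proof.
apply: le_trans (ent_le R (t := S n) _) _ => //.
by rewrite size_S natrX lnXn ?ltr0n // mulr_natr.
Qed.

Lemma h_le n : h n <= ln (size D)%:R * n%:R.
Proof. by apply: le_trans (ent_S_le n); rewrite lam_le_ent ?S_gt0 ?pX_gt0. Qed.

Lemma lam_S_scale n k c : (0 < k)%N -> (q ^ n <= c * k)%N ->
  lam (S n) k <= ln (2 * M * c + c + 1)%:R.
Proof.
move=> k0 nck; apply: le_trans (lam_interval R k0 (@S_interval n)) _.
rewrite lerBlDr -ln_natM ?addn1 //; apply: ler_ln_nat.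
have : (2 * M * q ^ n <= 2 * M * (c * k))%N by rewrite leq_mul2l nck orbT.
have := qX_gt0 n; lia.
Qed.

(* Between the scales [p^(i+j)] and [p^i q^j] the entropy comes from the summand
   [p^i S_j], above [p^i q^j] from [q^j S_i]. *)
Lemma h_superadd i j :
  h i + h j - (ln 2%:R + ln (2 * M + 2)%:R) <= h (i + j)%N.
Proof.
rewrite /h (lam_perm R _ (S_add i j)).
set A := dil (q ^ j) (S i); set B := dil (p ^ i) (S j).
have A0 : (0 < size A)%N by rewrite size_dil S_gt0.
have B0 : (0 < size B)%N by rewrite size_dil S_gt0.
have kK : (p ^ (i + j) <= p ^ i * q ^ j)%N by rewrite expnD leq_mul2l pqX orbT.
have := lam_diff_addS R A0 B0 (pX_gt0 (i + j)) kK.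
have := lam_addr R B0 A0 (k := p ^ i * q ^ j).
rewrite muln_gt0 pX_gt0 qX_gt0 => /(_ isT).
rewrite {1}[(p ^ i * _)%N]mulnC lam_dil ?S_gt0 ?pX_gt0 ?qX_gt0 //.
rewrite expnD !(lam_dil R (pX_gt0 i) (S_gt0 j)) ?pX_gt0 ?qX_gt0 //.
have := @lam_S_scale j (q ^ j) 1 (qX_gt0 j); rewrite mul1n leqnn => /(_ isT).
rewrite muln1 -addnA; lra.
Qed.

Lemma h_alpha : exists alpha : R, [/\ 0 <= alpha,
    forall n, h n <= alpha * n%:R + (ln 2%:R + ln (2 * M + 2)%:R) &
    forall e : R, 0 < e ->
      exists2 K : R, 0 <= K & forall n, (alpha - e) * n%:R - K <= h n].
Proof.
apply: fekete h_ge0 h_le _ h_superadd.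
by rewrite addr_ge0 ?ln_nat_ge0.
Qed.

(** The growth of [S_J] over a window of [t] doublings. The exponents convert doublings into
    letters: [(q/p)^b] is [2^j] up to a factor [q], and [(q/p)^a <= 2^t]. After the first
    [J - a - b] letters are dropped, [q^b S_a] provides [h a] at the lower scale; [q] times the
    upper scale is at least [q^(a+b)], so only a bounded entropy is left there. *)
Lemma inc_S J j t a b : (a + b <= J)%N -> (2 ^ j * p ^ b <= q ^ b)%N ->
  (q ^ b <= q * (2 ^ j * p ^ b))%N -> (q ^ a <= 2 ^ t * p ^ a)%N ->
  h a - (ln 2%:R + ln (2 * M * q + q + 1)%:R) <= inc (S J) (2 ^ j * p ^ J) (2 ^ t).
Proof.
move=> abJ hb1 hb2 ha.
have t0 n : (0 < 2 ^ n)%N by rewrite expn_gt0.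
have [c Jc] : exists c, J = (c + (a + b))%N by exists (J - (a + b))%N; lia.
apply: (@le_trans _ _ (inc (S (a + b)) (2 ^ j * p ^ (a + b)) (2 ^ t))); last first.
  have eJ : (2 ^ j * p ^ J = p ^ c * (2 ^ j * p ^ (a + b)))%N.
    by rewrite Jc [in LHS]expnD mulnCA.
  rewrite eJ {eJ} Jc (inc_perm R _ _ (S_add c (a + b))).
  apply: le_trans (inc_addS R _ _ _ _); rewrite ?size_dil ?S_gt0 ?muln_gt0 ?t0 ?pX_gt0 //.
  by rewrite inc_dil ?S_gt0 ?pX_gt0 // muln_gt0 t0 pX_gt0.
have h1 : lam (S (a + b)) (2 ^ j * p ^ (a + b) * 2 ^ t) <= ln (2 * M * q + q + 1)%:R.
  apply: lam_S_scale; first by rewrite !muln_gt0 !t0 pX_gt0.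
  rewrite !expnD; apply: leq_trans (leq_mul ha hb2) _.
  apply: eq_leq; ring.
have h2 : h a - ln 2%:R <= lam (S (a + b)) (2 ^ j * p ^ (a + b)).
  rewrite (lam_perm R _ (S_add a b)).
  have k0 : (0 < 2 ^ j * p ^ (a + b))%N by rewrite muln_gt0 t0 pX_gt0.
  apply: (le_trans _ (lam_addr R _ _ k0)); rewrite ?size_dil ?S_gt0 //.
  have := @lam_scale_le R (dil (q ^ b) (S a)) (2 ^ j * p ^ (a + b)) (q ^ b * p ^ a).
  rewrite size_dil S_gt0 k0 => /(_ isT isT).
  rewrite lam_dil ?S_gt0 ?pX_gt0 ?qX_gt0 // -/(h a) => H.
  rewrite lerBlDr; apply: H.
  by rewrite expnD mulnCA [leqRHS]mulnC leq_mul2l hb1 orbT.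
rewrite /inc; lra.
Qed.

End Cylinders.

(** * Branching scales and chains *)

Definition gap (s w : nat) (x : int * int) : bool := s%:Z <= x.2 - x.1 < w%:Z.

Definition points (P : seq (int * int)) : seq int :=
  flatten [seq [:: x.1; x.2] | x <- P].

Lemma size_points P : size (points P) = (2 * size P)%N.
Proof. by elim: P => //= x P; rewrite /points /= => ->; lia. Qed.

(** Pairs are removed greedily. The share of matched points measures branching: unmatched points
    carry almost no entropy between the scales [s] and [w], and matched pairs are the links from
    which chains are built. *)
Lemma maximal_matching (s w : nat) (B : seq int) : uniq B -> (0 < s)%N ->
  exists P T, [/\ perm_eq B (points P ++ T), all (gap s w) P &
    {in T &, forall x y, ~~ gap s w (x, y)}].
Proof.
move=> uB s0; have [n] := ubnP (size B); elim: n B uB => // n IH B uB Bn.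
have [/hasP[x xB /hasP[y yB xy]]|no] := boolP (has (fun x => has (fun y => gap s w (x, y)) B) B).
  have yx : y != x by apply/eqP => e; move: xy; rewrite /gap e /=; lia.
  have yB' : y \in rem x B by rewrite mem_rem_uniq // inE yx.
  have [||P [T [BPT gP gT]]] := IH (rem y (rem x B)).
  - by rewrite !rem_uniq.
  - by rewrite !size_rem //; move: Bn; case: (B) xB => //= ? ? _; lia.
  exists ((x, y) :: P), T; split => //=; last by rewrite xy.
  apply: (perm_trans (perm_to_rem xB)); rewrite perm_cons.
  by apply: (perm_trans (perm_to_rem yB')); rewrite perm_cons.
exists [::], B; split => // x y xB yB; apply: contra no => xy.
by apply/hasP; exists x => //; apply/hasP; exists y.
Qed.

Section Branching.
Variable R : realType.
Notation ent := (entropy R).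

Definition cell (k : nat) (x : int) : int := (x %/ k%:Z)%Z.

(** Unlike [scale_entropy] this is the entropy for a fixed grid, whose cells at scales [k] and
    [k * c] are nested; it suits counting inside cells. *)
Definition cell_entropy (k : nat) (B : seq int) : R := ent [seq cell k x | x <- B].
Notation cent := cell_entropy.

Lemma cellP k x : (0 < k)%N -> k%:Z * cell k x <= x < k%:Z * cell k x + k%:Z.
Proof.
move=> k0; rewrite /cell; have := divz_eq x k.
have := ltz_pmod x (d := k); have := modz_ge0 x (d := k); lia.
Qed.

Lemma cell_mul k c x : (0 < k)%N -> (0 < c)%N ->
  cell (k * c) x = cell c (cell k x).
Proof.
move=> k0 c0; have := cellP x k0; have := cellP (cell k x) c0.
have kc0 : (0 < k * c)%N by rewrite muln_gt0 k0.
have := cellP x kc0; rewrite PoszM.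
set a := cell c _; set b := cell k _; set d := cell _ x; nia.
Qed.

(* Unmatched points in a common cell of length [s G] are less than [s] apart, so
   they occupy at most two subcells of length [s]. *)
Lemma cent_branch (B T : seq int) (s G : nat) (M : seq (int * int)) :
  (0 < s)%N -> (0 < G)%N -> uniq B -> (0 < size B)%N ->
  perm_eq B (points M ++ T) ->
  {in T &, forall x y, ~~ gap s (s * G) (x, y)} ->
  cent s B <= cent (s * G) B + 2%:R * ln 2%:R +
    (2 * size M)%:R / (size B)%:R * ln G%:R.
Proof.
move=> s0 G0 uB B0 BMT gT.
(* One [ln 2] of the bound pays for recording whether a point is unmatched, the other for the two
   subcells of the unmatched points. *)
pose g x := (x \in T, cell (s * G) x).
have h1 : cent s B <= ent [seq (cell s x, g x) | x <- B] by exact: ent_pairl_le.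
have h2 : ent [seq g x | x <- B] <= cent (s * G) B + ln 2%:R.
  by apply: ent_cond_le => w _; exists [:: true; false] => // v _ _; case: (v \in T).
apply: (le_trans h1); rewrite ent_cond.
suff : (\sum_(w <- B) ent [seq cell s v | v <- B & g v == g w]) / (size B)%:R <=
    ln 2%:R + (2 * size M)%:R / (size B)%:R * ln G%:R by lra.
have sGE : (0 < s * G)%N by rewrite muln_gt0 s0.
have bT w : w \in T -> ent [seq cell s v | v <- B & g v == g w] <= ln 2%:R.
  move=> wT; have near v : v \in T -> cell (s * G) v = cell (s * G) w -> `|v - w| < s%:Z.
    move=> vT cv; have := cellP v sGE; have := cellP w sGE; rewrite cv.
    have := gT _ _ vT wT; have := gT _ _ wT vT; rewrite /gap /=; lia.
  have near2 u v : u \in T -> v \in T -> cell (s * G) u = cell (s * G) w ->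
      cell (s * G) v = cell (s * G) w -> `|cell s u - cell s v| <= 1.
    move=> uT vT cu cv; have := cellP u sGE; have := cellP v sGE; rewrite cu cv.
    have := gT _ _ vT uT; have := gT _ _ uT vT; rewrite /gap /=.
    have := cellP u s0; have := cellP v s0; nia.
  (* As these subcells differ pairwise by at most 1, they cannot include both neighbours of
     [cell s w]. *)
  have [/hasP[u _ /andP[/eqP[uT cu] /eqP eu]]|no] :=
      boolP (has (fun v => (g v == g w) && (cell s v == cell s w + 1)) B).
    apply: (ent_le R (t := [:: cell s w; cell s w + 1])) => _ /mapP[v + ->].
    rewrite mem_filter => /andP[/eqP[vT cv] _]; rewrite !inE.
    rewrite wT in uT vT.
    have := near2 _ _ uT vT cu cv; have := near2 _ _ wT vT erefl cv; lia.
  apply: (ent_le R (t := [:: cell s w - 1; cell s w])) => _ /mapP[v + ->].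
  rewrite mem_filter => /andP[gv vB]; rewrite !inE.
  have nv : cell s v != cell s w + 1.
    by apply: contra no => e; apply/hasP; exists v => //; rewrite gv.
  move: gv => /eqP[vT cv]; rewrite wT in vT.
  have := near2 _ _ wT vT erefl cv; lia.
have bG w : ent [seq cell s v | v <- B & g v == g w] <= ln G%:R.
  apply: (ent_interval R (a := G%:Z * cell (s * G) w)) => _ /mapP[v + ->].
  rewrite mem_filter => /andP[/eqP[_ cv] _]; rewrite -cv cell_mul //.
  exact: cellP.
rewrite (perm_big _ BMT) big_cat /= mulrDl addrC; apply: lerD.
  apply: (@le_trans _ _ ((\sum_(i <- B) ln 2%:R) / (size B)%:R)); last first.
    by rewrite avg_const.
  rewrite ler_pM2r ?invr_gt0 ?ltr0n // (perm_big _ BMT) big_cat /= big_seq.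
  rewrite -[leLHS]add0r; apply: lerD; first by rewrite sumr_ge0 // => *; exact: ln_nat_ge0.
  by rewrite [leRHS]big_seq; apply: ler_sum => i iT; exact: bT.
rewrite mulrAC ler_pM2r ?invr_gt0 ?ltr0n // -size_points -sum1_seq mulr_suml.
by apply: ler_sum => i _; rewrite mul1r.
Qed.

Lemma cent_mul_le k c B : (0 < k)%N -> (0 < c)%N ->
  cent k B <= cent (k * c) B + ln c%:R.
Proof.
move=> k0 c0; apply: le_trans (ent_pairl_le R (cell k) (cell (k * c)) B) _.
apply: ent_cond_le => w _; exists [seq c%:Z * cell (k * c) w + i | i <- ints_below c].
  by rewrite size_map size_U.
move=> v _ cv; apply/mapP; exists (cell k v - c%:Z * cell (k * c) w); last by lia.
rewrite mem_U -cv cell_mul //; have := cellP (cell k v) c0; lia.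
Qed.

Lemma cent_sep k B : (0 < k)%N -> uniq B ->
  {in B &, forall x y, x < y -> k%:Z <= y - x} -> cent k B = ln (size B)%:R.
Proof.
move=> k0 uB sep; rewrite /cent ent_inj1 ?ent_uniq // => x y xB yB cxy.
have := cellP x k0; have := cellP y k0; rewrite cxy.
case: (ltgtP x y) => // xy; first by have := sep _ _ xB yB xy; lia.
by have := sep _ _ yB xB xy; lia.
Qed.

Lemma cent_interval k B (a : int) : (0 < k)%N ->
  {in B, forall x, a <= x < a + k%:Z} -> cent k B <= ln 2%:R.
Proof.
move=> k0 H; apply: (ent_interval R (a := cell k a)) => _ /mapP[x /H + ->].
have := cellP x k0; have := cellP a k0; nia.
Qed.

(* Telescoping in steps of [g] doublings leaves [g] scales at either end: at
   the bottom every entropy is nearly [ln #|B|], at the top at most [ln 2]. *)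
Lemma sum_matching (B : seq int) (a : int) (s0 E g : nat)
    (M : nat -> seq (int * int)) (T : nat -> seq int) :
  (0 < s0)%N -> (0 < g)%N -> uniq B -> (0 < size B)%N ->
  {in B &, forall x y, x < y -> s0%:Z <= y - x} ->
  {in B, forall x, a <= x < a + (s0 * 2 ^ E)%N%:Z} ->
  (forall j, perm_eq B (points (M j) ++ T j)) ->
  (forall j, {in T j &, forall x y, ~~ gap (s0 * 2 ^ j) (s0 * 2 ^ j * 2 ^ g) (x, y)}) ->
  g%:R * (ln (size B)%:R - (g.+1)%:R * ln 2%:R) <=
  E%:R * (2%:R * ln 2%:R) +
  g%:R * ln 2%:R * \sum_(0 <= j < E) (2 * size (M j))%:R / (size B)%:R :> R.
Proof.
move=> s00 g0 uB B0 sep BE BMT gT.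
have X0 j : (0 < 2 ^ j)%N by rewrite expn_gt0.
have k0 j : (0 < s0 * 2 ^ j)%N by rewrite muln_gt0 s00 X0.
pose H j := cent (s0 * 2 ^ j) B.
have HD i j : cent (s0 * 2 ^ i * 2 ^ j) B = H (i + j)%N by rewrite /H expnD mulnA.
have lnX j : ln (2 ^ j)%:R = j%:R * ln 2%:R :> R by rewrite natrX lnXn // mulr_natl.
have step j : H j - H (j + g)%N <= 2%:R * ln 2%:R +
    g%:R * ln 2%:R * ((2 * size (M j))%:R / (size B)%:R).
  have := cent_branch (k0 j) (X0 g) uB B0 (BMT j) (gT j).
  rewrite HD lnX -/(H j); lra.
have low j : ln (size B)%:R - j%:R * ln 2%:R <= H j.
  have := cent_mul_le B (k0 0%N) (X0 j); rewrite lnX HD add0n /= expn0 muln1.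
  by rewrite cent_sep //; lra.
have high j : H (E + j)%N <= ln 2%:R.
  apply: (cent_interval (a := a)) => // x /BE; rewrite expnD mulnA.
  have : (s0 * 2 ^ E <= s0 * 2 ^ E * 2 ^ j)%N by rewrite leq_pmulr.
  lia.
have tel : \sum_(0 <= j < E) (H j - H (j + g)%N) =
    \sum_(0 <= j < g) H j - \sum_(0 <= j < g) H (E + j)%N.
  rewrite sumrB; have e1 : \sum_(0 <= j < E + g) H j =
      \sum_(0 <= j < E) H j + \sum_(0 <= j < g) H (E + j)%N.
    rewrite (@big_cat_nat _ _ _ E) ?leq_addr //=; congr (_ + _).
    by rewrite -{1}[E]add0n (addnC _ g) big_addn addnK; apply: eq_bigr => i _; rewrite addnC.
  have e2 : \sum_(0 <= j < E + g) H j =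
      \sum_(0 <= j < g) H j + \sum_(0 <= j < E) H (j + g)%N.
    rewrite (@big_cat_nat _ _ _ g) ?leq_addl //=; congr (_ + _).
    by rewrite -{1}[g]add0n big_addn addnK.
  lra.
have l2 : 0 <= ln 2%:R :> R by exact: ln_nat_ge0.
have cst n c : \sum_(0 <= j < n) c = n%:R * c :> R.
  by rewrite sumr_const_nat subn0 mulr_natl.
have b1 : g%:R * (ln (size B)%:R - g%:R * ln 2%:R) <= \sum_(0 <= j < g) H j.
  rewrite -cst big_nat [leRHS]big_nat; apply: ler_sum => j /andP[_ jg].
  apply: le_trans (low j); rewrite lerD2l lerN2 ler_wpM2r // ler_nat; exact: ltnW.
have b2 : \sum_(0 <= j < g) H (E + j)%N <= g%:R * ln 2%:R.
  by rewrite -cst; apply: ler_sum => j _; exact: high.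
have b3 : \sum_(0 <= j < E) (H j - H (j + g)%N) <= E%:R * (2%:R * ln 2%:R) +
    g%:R * ln 2%:R * \sum_(0 <= j < E) (2 * size (M j))%:R / (size B)%:R.
  by rewrite mulr_sumr -cst -big_split /=; apply: ler_sum => j _; exact: step.
rewrite -natr1; lra.
Qed.

End Branching.

Definition sumS (n : nat) (B : seq int) : seq int := iter n (addS B) [:: 0].

Lemma size_sumS n B : size (sumS n B) = (size B ^ n)%N.
Proof. by elim: n => //= n IH; rewrite size_addS IH expnS. Qed.

Lemma sumS_D m n B : perm_eq (sumS (m + n) B) (addS (sumS m B) (sumS n B)).
Proof.
elim: m => [|m IH]; first by rewrite add0n perm_sym (perm_trans (addSC _ _)) //= addS0.
by rewrite addSn /= -addSA; apply: perm_addS.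
Qed.

Lemma sumS_M m n B : perm_eq (sumS (m * n) B) (sumS m (sumS n B)).
Proof.
elim: m => //= m IH; rewrite mulSn; apply: (perm_trans (sumS_D _ _ _)).
exact: perm_addS.
Qed.

Lemma addS_catr (s t1 t2 : seq int) :
  perm_eq (addS s (t1 ++ t2)) (addS s t1 ++ addS s t2).
Proof.
apply: (perm_trans (addSC _ _)); rewrite addS_catl; apply: perm_cat; exact: addSC.
Qed.

Definition chain (s w : nat) (c : seq int) : bool :=
  sorted (fun x y => gap s w (x, y)) c.

Lemma chain_shift s w y c : chain s w [seq y + x | x <- c] = chain s w c.
Proof.
case: c => //= x c; elim: c x => //= z c IH x; rewrite IH; congr andb.
by rewrite /gap /= (_ : y + z - (y + x) = z - x) //; lia.
Qed.

Lemma chain_sep s w c : (0 < s)%N -> chain s w c ->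
  uniq c /\ {in c &, forall x y, x < y -> s%:Z <= y - x}.
Proof.
move=> s0 cc; pose r x y := x + s%:Z <= y.
have rt : transitive r by move=> y x z; rewrite /r; lia.
have : sorted r c.
  move: cc; rewrite /chain; case: c => //= x c; apply: sub_path => y z.
  by rewrite /gap /r /=; lia.
rewrite sorted_pairwise // => pc; split.
  by apply: (pairwise_uniq (r := r)) pc => x; rewrite /r; lia.
elim: c {cc} pc => //= z c IH /andP[/allP zc /IH{}IH] x y.
rewrite !inE => /orP[/eqP->|xc] /orP[/eqP->|yc]; first by rewrite ltxx.
- by move=> _; have := zc _ yc; rewrite /r; lia.
- by have := zc _ xc; rewrite /r; lia.
- exact: IH.
Qed.

Lemma chain_interval s w x c : chain s w (x :: c) ->
  {in x :: c, forall y, x <= y < x + (size c * w + 1)%N%:Z}.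
Proof.
elim: c x => [|z c IH] x /=; first by move=> _ y; rewrite inE => /eqP ->; lia.
move=> /andP[xz /IH zc] y; rewrite inE => /orP[/eqP ->|/zc]; first by lia.
by move: xz; rewrite /gap /=; lia.
Qed.

Section Chains.
Variable R : realType.
Notation inc := (scale_increment R).

(** The points are [s] apart, so all [Q + 1] are visible at scale [s]; they span at most [s G Q], so
    at most [ln (G + 2)] remains at scale [s Q]. *)
Lemma inc_chain s G Q c : (0 < s)%N -> (0 < Q)%N -> chain s (s * G) c ->
  size c = Q.+1 -> ln Q%:R - ln G.+2%:R <= inc c s Q.
Proof.
move=> s0 Q0 cc sc; have [uc sepc] := chain_sep s0 cc.
have c0 : (0 < size c)%N by rewrite sc.
have sQ0 : (0 < s * Q)%N by rewrite muln_gt0 s0.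
rewrite /scale_increment lam_sep //.
have : scale_entropy R c (s * Q) <= ln (s * Q * G.+2)%:R - ln (s * Q)%:R.
  case: c cc sc {uc sepc c0} => // x c cc [sc].
  apply: le_trans (lam_interval R sQ0 (chain_interval cc)) _.
  rewrite lerD2r; apply: ler_ln_nat; rewrite sc; lia.
rewrite (ln_natM R sQ0) // sc.
have : ln Q%:R <= ln Q.+1%:R :> R by apply: ler_ln_nat.
lra.
Qed.

(* The longer chain is [x + head c] followed by [y + c]. *)
Lemma addS_pair_chain s w x y c : gap s w (x, y) -> chain s w c -> c != [::] ->
  exists c' T, [/\ perm_eq (addS [:: x; y] c) (c' ++ T), chain s w c' &
    size c' = (size c).+1].
Proof.
case: c => // z c xy cc _.
exists (x + z :: [seq y + i | i <- z :: c]), [seq x + i | i <- c]; split.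
- rewrite /addS /= cats0 perm_cons perm_sym -cat_cons.
  by rewrite perm_catC.
- rewrite /chain /=; apply/andP; split; last by rewrite -[path _ _ _]/(chain s w (map _ (z :: c))) chain_shift.
  by move: xy; rewrite /gap /=; lia.
- by rewrite /= size_map.
Qed.

Lemma addS_pairs_chains s w P C l : all (gap s w) P ->
  all (fun c => chain s w c && (size c == l.+1)) C ->
  exists C' T, [/\ perm_eq (addS (points P) (flatten C)) (flatten C' ++ T),
    all (fun c => chain s w c && (size c == l.+2)) C' &
    size C' = (size P * size C)%N].
Proof.
move=> gP gC; elim: P gP => [_|[x y] P IHP /= /andP[xy /IHP[C1 [T1 [e1 a1 s1]]]]].
  by exists [::], [::].
have [C2 [T2 [e2 a2 s2]]] : exists C' T,
    [/\ perm_eq (addS [:: x; y] (flatten C)) (flatten C' ++ T),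
    all (fun c => chain s w c && (size c == l.+2)) C' & size C' = size C].
  elim: C gC {IHP e1 s1} => [_|c C IHC /= /andP[/andP[cc /eqP sc] /IHC[C2 [T2 [e2 a2 s2]]]]].
    by exists [::], [::].
  have cn : c != [::] by case: (c) sc.
  have [c' [T' [e' cc' sc']]] := addS_pair_chain xy cc cn.
  exists (c' :: C2), (T' ++ T2); split => /=.
  - apply: perm_trans (addS_catr _ _ _) _; apply: perm_trans (perm_cat e' e2) _.
    by rewrite -!catA perm_cat2l perm_catCA.
  - by rewrite cc' sc' sc eqxx.
  - by rewrite s2.
exists (C2 ++ C1), (T2 ++ T1); split.
- rewrite -[points _]/([:: x; y] ++ points P) addS_catl flatten_cat.
  apply: perm_trans (perm_cat e2 e1) _.
  by rewrite -!catA perm_cat2l perm_catCA.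
- by rewrite all_cat a2.
- by rewrite size_cat s1 s2 mulSn.
Qed.

(** Choosing one pair for each of the [l] summands gives [2^l] sums, of which [l + 1] form a chain:
    the pairs are switched from [x] to [y] one at a time. The chains have a small share of the mass,
    but one bounded below in terms of [l] and the matched share. *)
Lemma sumS_chains s w P T B l : all (gap s w) P -> perm_eq B (points P ++ T) ->
  exists C Z, [/\ perm_eq (sumS l B) (flatten C ++ Z),
    all (fun c => chain s w c && (size c == l.+1)) C & size C = (size P ^ l)%N].
Proof.
move=> gP BPT; elim: l => [|l [C [Z [eC aC sC]]]].
  by exists [:: [:: 0]], [::].
have [C' [Z' [eC' aC' sC']]] := addS_pairs_chains gP aC.
exists C', (Z' ++ (addS (points P) Z ++ addS T (flatten C ++ Z))); split => //.
  rewrite /= -/(sumS l B); apply: perm_trans (perm_addS BPT eC) _.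
  rewrite addS_catl !catA perm_cat2r.
  by apply: perm_trans (addS_catr _ _ _) _; rewrite perm_cat2r.
by rewrite sC' sC expnS.
Qed.

(* The part of [Z + ... + Z] in which at least one summand is in [F] is a union
   of sums of [F] with something, and adding a summand never decreases [inc]. *)
Lemma sumS_inc (Z F T : seq int) s Q (v : R) n : (0 < s)%N -> (0 < Q)%N ->
  perm_eq Z (F ++ T) ->
  (size F)%:R * v <= (size F)%:R * inc F s Q ->
  ((size Z)%:R ^+ n - (size T)%:R ^+ n) * v <= (size Z)%:R ^+ n * inc (sumS n Z) s Q.
Proof.
move=> s0 Q0 ZFT hF.
suff [L [eL hL]] : exists L, perm_eq (sumS n Z) (L ++ sumS n T) /\
    (size L)%:R * v <= (size L)%:R * inc L s Q.
  have := inc_cat R L (sumS n T) s0 Q0.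
  rewrite -(perm_size eL) -(inc_perm R s Q eL) !size_sumS !natrX.
  have : (size L)%:R = (size Z)%:R ^+ n - (size T)%:R ^+ n :> R.
    have := perm_size eL; rewrite size_cat !size_sumS => /(congr1 (fun n => n%:R : R)).
    by rewrite natrD !natrX => ->; rewrite addrK.
  move=> eq; rewrite -eq.
  have : 0 <= (size T)%:R ^+ n * inc (sumS n T) s Q.
    case: (posnP (size (sumS n T))) => [|T0].
      by rewrite size_sumS => /(congr1 (fun n => n%:R : R)); rewrite natrX => ->; rewrite mul0r.
    by rewrite mulr_ge0 ?exprn_ge0 // inc_ge0.
  lra.
elim: n => [|n [L [eL hL]]].
  by exists [::]; split => //=; rewrite !mul0r.
have dich (A : seq int) (B : seq int) : (size B)%:R * v <= (size B)%:R * inc B s Q ->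
    (size (addS A B))%:R * v <= (size (addS A B))%:R * inc (addS A B) s Q.
  case: (posnP (size (addS A B))) => [->|]; first by rewrite !mul0r.
  rewrite {1}size_addS muln_gt0 => /andP[A0 B0].
  rewrite ler_pM2l ?ltr0n // => h; rewrite ler_wpM2l //.
  by apply: (le_trans h); exact: inc_addS.
exists (addS F (sumS n Z) ++ addS T L); split.
  rewrite /= -/(sumS n Z) -/(sumS n T); apply: perm_trans (perm_addS ZFT (perm_refl _)) _.
  rewrite addS_catl -catA perm_cat2l; apply: perm_trans (perm_addS (perm_refl T) eL) _.
  exact: addS_catr.
have := inc_cat R (addS F (sumS n Z)) (addS T L) s0 Q0.
have h1 := dich T L hL; have h2 := dich (sumS n Z) F hF.
apply: le_trans; rewrite size_cat natrD mulrDl; apply: lerD => //.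
rewrite (inc_perm R s Q (addSC F _)) (perm_size (addSC F _)) //.
Qed.

(** A [Q]-fold sum lies in a chain with probability at least [(c / 2)^Q], which the number
    [size P ^ Q] of chains already gives; among [n] independent ones the chance that none does is at
    most [(1 - (c / 2)^Q)^n]. *)
Lemma inc_sumS_matching (B T : seq int) P (s G Q n : nat) (c : R) :
  (0 < s)%N -> (G.+2 <= Q)%N -> (0 < size B)%N ->
  perm_eq B (points P ++ T) -> all (gap s (s * G)) P ->
  0 <= c -> c <= (2 * size P)%:R / (size B)%:R ->
  (1 - (1 - (c / 2%:R) ^+ Q) ^+ n) * (ln Q%:R - ln G.+2%:R) <=
    inc (sumS (n * Q) B) s Q.
Proof.
move=> s0 GQ B0 BPT gP c0 cP; have Q0 : (0 < Q)%N by lia.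
have [C [Z [eC aC sC]]] := sumS_chains Q gP BPT.
set v := ln Q%:R - ln G.+2%:R.
have v0 : 0 <= v by rewrite subr_ge0; exact: ler_ln_nat.
have szF : size (flatten C) = (size C * Q.+1)%N.
  elim: C aC {eC sC} => //= a C IH /andP[/andP[_ /eqP sa] /IH e].
  by rewrite size_cat e sa mulSn.
have hF : (size (flatten C))%:R * v <= (size (flatten C))%:R * inc (flatten C) s Q.
  apply: le_trans (inc_flatten R C s0 Q0).
  have -> : (size (flatten C))%:R * v = \sum_(c <- C) Q.+1%:R * v.
    rewrite szF natrM -(sum1_seq R C) -mulrA mulr_suml.
    by under eq_bigr do rewrite mul1r.
  rewrite big_seq [leRHS]big_seq; apply: ler_sum => a /(allP aC) /andP[ca /eqP sa].
  rewrite sa ler_wpM2l //; exact: inc_chain.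
have := sumS_inc n s0 Q0 eC hF; rewrite -(inc_perm R s Q (sumS_M n Q B)).
have Zs : size (sumS Q B) = (size B ^ Q)%N by rewrite size_sumS.
rewrite Zs natrX; set b := (size B)%:R ^+ Q.
have b0 : 0 < b by rewrite exprn_gt0 // ltr0n.
rewrite -ler_pdivrMl ?exprn_gt0 ?ltr0n //; apply: le_trans.
rewrite mulrA; apply: ler_wpM2r => //.
have bn0 : b ^+ n != 0 by rewrite expf_neq0 // gt_eqF.
rewrite mulrBr mulVf // lerD2l lerN2.
rewrite -exprVn -exprMn; apply: lerXn2r.
- by rewrite nnegrE mulr_ge0 // invr_ge0 ltW.
- rewrite nnegrE subr_ge0 exprn_ile1 // ?divr_ge0 // ler_pdivrMr ?ltr0n // mul1r.
  apply: (le_trans cP); rewrite ler_pdivrMr ?ltr0n // -natrM ler_nat.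
  rewrite (perm_size BPT) size_cat size_points; lia.
have sZ : (size Z)%:R = b - (size (flatten C))%:R.
  rewrite /b -natrX -Zs (perm_size eC) size_cat natrD; lra.
rewrite sZ mulrBr mulVf ?gt_eqF // lerD2l lerN2 ler_pdivlMl //.
rewrite szF sC natrM natrX.
apply: (@le_trans _ _ ((size P)%:R ^+ Q)); last by rewrite ler_peMr ?exprn_ge0 // ler1n.
rewrite /b -exprMn; apply: lerXn2r; rewrite ?nnegrE ?mulr_ge0 ?divr_ge0 //.
move: cP; rewrite ler_pdivlMr ?ltr0n // natrM; lra.
Qed.

End Chains.

(** * Thick fibres with small entropy gain *)

Lemma exists_ge_avg (R : realType) (T : eqType) (s : seq T) (F : T -> R) :
  (0 < size s)%N -> exists2 x, x \in s & (\sum_(y <- s) F y) / (size s)%:R <= F x.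
Proof.
move=> s0; suff [x xs hx] : exists2 x, x \in s & \sum_(y <- s) F y <= (size s)%:R * F x.
  by exists x => //; rewrite ler_pdivrMr ?ltr0n // mulrC.
case: s s0 => // x s _; elim: s x => [|y s IH] x.
  by exists x; rewrite ?mem_head // big_seq1 mul1r.
have [z zs hz] := IH y; rewrite big_cons.
rewrite [size _]/= -natr1 mulrDl mul1r in hz *.
have s0 : 0 <= (size s)%:R + 1 :> R by rewrite addr_ge0.
have [xz|zx] := leP (F x) (F z).
  exists z; first by rewrite inE zs orbT.
  by rewrite -natr1 !mulrDl !mul1r in hz *; lra.
exists x; first by rewrite mem_head.
rewrite -natr1 !mulrDl !mul1r in hz *.
have : (size s)%:R * F z <= (size s)%:R * F x by rewrite ler_wpM2l // ltW.
lra.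
Qed.

(** Here [P = p^n], [Q = q^J], and [A], [B] index the cells of [w] and of [Q w + P x + i]. Since
    [P x] is at most [M P Q] in size and [i] is less than [P Q], the sum determines the cell of [w]
    up to [2 M + 4] choices. *)
Lemma fibre_window (P Q s M : nat) (A B i w x : int) :
  (s <= P * Q)%N -> 0 <= i < s%:Z ->
  P%:Z * A <= w < P%:Z * A + P%:Z ->
  (P * Q)%N%:Z * B <= Q%:Z * w + (P%:Z * x + i) < (P * Q)%N%:Z * B + (P * Q)%N%:Z ->
  - (M * Q)%N%:Z <= x < - (M * Q)%N%:Z + (2 * M * Q + 1)%N%:Z ->
  0 <= A - (B - (M + 2)%N%:Z) < (2 * M + 4)%N%:Z.
Proof.
move=> sPQ i0 wA zB xM.
have u0 : 0 < P%:Z * Q%:Z by lia.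
have h1 : P%:Z * Q%:Z * A <= Q%:Z * w by nia.
have h2 : Q%:Z * w <= P%:Z * Q%:Z * A + P%:Z * Q%:Z by nia.
have h3 : - M%:Z * (P%:Z * Q%:Z) <= P%:Z * x by nia.
have h4 : P%:Z * x <= M%:Z * (P%:Z * Q%:Z) by nia.
move: u0 h1 h2 h3 h4 zB; rewrite !PoszM.
have : s%:Z <= P%:Z * Q%:Z by lia.
move: (P%:Z * Q%:Z) (Q%:Z * w) (P%:Z * x) => u y z su u0 h1 h2 h3 h4 /andP[b1 b2].
have c1 : u * (A - M%:Z) < u * (B + 1) by lia.
have c2 : u * B < u * (A + M%:Z + 2) by lia.
rewrite !ltr_pM2l // in c1 c2; lia.
Qed.

Section Fibres.
Variable R : realType.
Notation ent := (entropy R).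
Notation lam := (scale_entropy R).
Notation cent := (cell_entropy R).

Definition fibre k (s : seq int) w := [seq v <- s | cell k v == cell k w].

(** Chain rule for the pair of [cell k w] and [phi w + y], in which the sum leaves at most [K]
    possibilities for the cell. The entropy of the sum thus splits into that of the cell and that
    inside the fibres. *)
Lemma ent_fibres (phi : int -> int) k (s t : seq int) K :
  (0 < size s)%N -> (0 < size t)%N ->
  (forall w y, w \in s -> y \in t -> exists2 u : seq int, (size u <= K)%N &
     {in s, forall w', {in t, forall y', phi w' + y' = phi w + y -> cell k w' \in u}}) ->
  cent k s + (\sum_(w <- s) ent (addS [seq phi v | v <- fibre k s w] t)) / (size s)%:R
    <= ent (addS [seq phi w | w <- s] t) + ln K%:R.
Proof.
move=> s0 t0 HK; set W := [seq (w, y) | w <- s, y <- t].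
have W0 : (0 < size W)%N by rewrite size_allpairs muln_gt0 s0.
have e1 : ent [seq cell k w.1 | w <- W] = cent k s by exact: ent_map_fst.
have e2 : ent [seq phi w.1 + w.2 | w <- W] = ent (addS [seq phi w | w <- s] t).
  by rewrite map_allpairs /addS allpairs_mapl.
have := @ent_cond_le R _ _ _ (fun w => cell k w.1) (fun w => phi w.1 + w.2) W K.
rewrite ent_pairC ent_cond e1 e2.
have -> : (\sum_(w <- W) ent [seq phi v.1 + v.2 | v <- W & cell k v.1 == cell k w.1])
    / (size W)%:R =
  (\sum_(w <- s) ent (addS [seq phi v | v <- fibre k s w] t)) / (size s)%:R.
  have fW w : [seq phi v.1 + v.2 | v <- W & cell k v.1 == cell k w] =
      addS [seq phi v | v <- fibre k s w] t.
    rewrite /W /fibre /addS; elim: (s) => //= x s' IH; rewrite filter_cat map_cat IH.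
    rewrite filter_map /=; case: ifP => fx /=.
      rewrite (eq_filter (a2 := predT)) ?filter_predT -?map_comp // => y /=.
    by rewrite (eq_filter (a2 := pred0)) ?filter_pred0 // => y /=.
  rewrite big_allpairs_dep /= size_allpairs.
  under eq_bigr => w _.
    under eq_bigr => y _ do rewrite fW.
    rewrite -[X in \sum_(y <- t) X]mul1r -mulr_suml sum1_seq.
    over.
  rewrite -mulr_sumr natrM; field; rewrite !pnatr_eq0; lia.
apply; move=> _ /allpairsP[[w y] [/= ws yt ->]] /=.
have [u uK Hu] := HK w y ws yt; exists u => // _ /allpairsP[[w' y'] [/= ws' yt' ->]] /=.
exact: Hu.
Qed.

(** Together with [cent_le_lam], the two entropies at scale [k] agree up to [ln 2]: the cell of [w]
    confines [w + y] to [2 k] values, and [w + y] confines the cell to two. *)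
Lemma lam_le_cent k s : (0 < size s)%N -> (0 < k)%N -> lam s k <= cent k s + ln 2%:R.
Proof.
move=> s0 k0; set W := [seq (w, y) | w <- s, y <- ints_below k].
have e1 : ent [seq cell k w.1 | w <- W] = cent k s.
  by apply: ent_map_fst; rewrite size_U.
have e2 : ent [seq w.1 + w.2 | w <- W] = ent (addS s (ints_below k)) by rewrite map_allpairs.
have h1 := ent_pairl_le R (fun w => w.1 + w.2) (fun w => cell k w.1) W.
have := @ent_cond_le R _ _ _ (fun w => w.1 + w.2) (fun w => cell k w.1) W (2 * k).
rewrite ln_natM // e1 e2 in h1 * => h2.
suff : ent [seq (w.1 + w.2, cell k w.1) | w <- W] <= cent k s + (ln 2%:R + ln k%:R).
  by rewrite /scale_entropy; lra.
apply: h2 => w _; exists [seq k%:Z * cell k w.1 + i | i <- ints_below (2 * k)].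
  by rewrite size_map size_U.
move=> _ /allpairsP[[v y] [/= vs yU ->]] /= cv.
apply/mapP; exists (v + y - k%:Z * cell k w.1); last by rewrite [RHS]addrC subrK.
move: yU; rewrite !mem_U -cv; have := cellP v k0; lia.
Qed.

Lemma cent_le_lam k s : (0 < size s)%N -> (0 < k)%N -> cent k s <= lam s k + ln 2%:R.
Proof.
move=> s0 k0; have U0 : (0 < size (ints_below k))%N by rewrite size_U.
have := @ent_fibres id k s (ints_below k) 2 s0 U0; rewrite map_id => H.
have : ln k%:R <= (\sum_(w <- s) ent (addS [seq id v | v <- fibre k s w] (ints_below k))) / (size s)%:R.
  rewrite -[leLHS](avg_const _ s0) ler_pM2r ?invr_gt0 ?ltr0n // big_seq [leRHS]big_seq.
  apply: ler_sum => w ws; rewrite map_id -ent_U ent_addSC; apply: ent_addS_ge => //.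
  by rewrite size_filter -has_count; apply/hasP; exists w => //=.
suff HK : forall w y : int, w \in s -> y \in ints_below k -> exists2 u : seq int, (size u <= 2)%N &
     {in s, forall w', {in ints_below k, forall y', w' + y' = w + y -> cell k w' \in u}}.
  by have := H HK; rewrite /scale_entropy; lra.
move=> w y ws yU; exists [:: cell k (w + y); cell k (w + y) - 1] => // w' ws' y'.
rewrite mem_U => yU' e; rewrite !inE -e.
have := cellP w' k0; have := cellP (w' + y') k0; nia.
Qed.

Variables (p q M : nat) (D : seq int).
Hypotheses (p0 : (0 < p)%N) (pq : (p < q)%N).
Hypotheses (D0 : (0 < size D)%N) (DM : {in D, forall d, `|d| <= M%:Z}).
Hypothesis uniqS : forall n, uniq (cylinder_sums p q D n).
Notation S := (cylinder_sums p q D).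
Notation h := (cylinder_entropy R p q D).

(** One fibre has to be both large and of small excess, so the two quantities are combined with
    weight [c] before averaging over all fibres. The absence of overlaps enters through [uniqS],
    which makes the entropy of [S n] equal to [n ln m]; the part not seen by the cells is the
    average log-size of a fibre. *)
Lemma exists_fibre n J (c : R) : 0 <= c ->
  exists B : seq int, [/\ uniq B, (0 < size B)%N, {subset B <= S n},
    exists a : int, {in B, forall x, a <= x < a + (p ^ n)%N%:Z} &
    n%:R * ln (size D)%:R - h n - ln 2%:R -
      c * (h (n + J)%N - h n - h J + (ln 2%:R + ln (2 * M + 4)%:R)) <=
    ln (size B)%:R -
      c * (lam (addS (dil (q ^ J) B) (dil (p ^ n) (S J))) (p ^ (n + J)) - h J)].
Proof.
move=> c0; set Y := dil (p ^ n) (S J); set s0 := (p ^ (n + J))%N.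
have Sn0 := S_gt0 p q D0 n.
have s00 : (0 < s0)%N by rewrite expn_gt0 p0.
have Y0 : (0 < size (addS Y (ints_below s0)))%N.
  by rewrite addS_gt0 ?size_dil ?size_U ?S_gt0.
have pn0 : (0 < p ^ n)%N by rewrite expn_gt0 p0.
have := @ent_fibres (fun x => (q ^ J)%N%:Z * x) (p ^ n) (S n) (addS Y (ints_below s0)) (2 * M + 4) Sn0 Y0.
have -> : ent (addS [seq (q ^ J)%N%:Z * w | w <- S n] (addS Y (ints_below s0))) = h (n + J) + ln s0%:R.
  rewrite /cylinder_entropy (lam_perm R _ (S_add p q D n J)) /scale_entropy addSA -/(dil _ _) -/Y -/s0; lra.
move=> H.
have HK : forall w y : int, w \in S n -> y \in addS Y (ints_below s0) ->
    exists2 u : seq int, (size u <= 2 * M + 4)%N &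
     {in S n, forall w', {in addS Y (ints_below s0), forall y',
       (q ^ J)%N%:Z * w' + y' = (q ^ J)%N%:Z * w + y -> cell (p ^ n) w' \in u}}.
  move=> w y wS yY.
  pose z := (q ^ J)%N%:Z * w + y.
  exists [seq cell (p ^ n * q ^ J) z - (M + 2)%N%:Z + i | i <- ints_below (2 * M + 4)].
    by rewrite size_map size_U.
  move=> w' wS' y' /allpairsP[[_ i] [/= /mapP[x xS ->] iU ->]] e.
  apply/mapP; exists (cell (p ^ n) w' - (cell (p ^ n * q ^ J) z - (M + 2)%N%:Z)); last by rewrite [RHS]addrC subrK.
  have qJ0 : (0 < q ^ J)%N by rewrite expn_gt0; apply/orP; left; lia.
  have := S_interval p0 pq D0 DM xS; have PQ0 : (0 < p ^ n * q ^ J)%N by rewrite muln_gt0 pn0.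
  have := cellP z PQ0; have := cellP w' pn0.
  have s0le : (s0 <= p ^ n * q ^ J)%N.
    by rewrite /s0 expnD leq_mul2l pqX ?orbT.
  rewrite /z -e; move: iU; rewrite !mem_U.
  apply: fibre_window => //.
have {H HK} := H HK.
have -> : (\sum_(w <- S n) ent (addS [seq (q ^ J)%N%:Z * v | v <- fibre (p ^ n) (S n) w]
    (addS Y (ints_below s0)))) / (size (S n))%:R =
  (\sum_(w <- S n) lam (addS (dil (q ^ J) (fibre (p ^ n) (S n) w)) Y) s0) / (size (S n))%:R
    + ln s0%:R.
  rewrite -[X in _ + X](avg_const (ln s0%:R) Sn0) -mulrDl -big_split /=; congr (_ / _).
  by apply: eq_bigr => w _; rewrite /scale_entropy addSA subrK.
move=> H.
have e1 : n%:R * ln (size D)%:R = cent (p ^ n) (S n) +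
    (\sum_(w <- S n) ln (size (fibre (p ^ n) (S n) w))%:R) / (size (S n))%:R.
  have := ent_cond R id (cell (p ^ n)) (S n).
  have -> : ent [seq (id w, cell (p ^ n) w) | w <- S n] = ent (S n).
    by apply: ent_inj1 => x y _ _ [].
  rewrite ent_uniq // size_S natrX lnXn ?ltr0n // -[ln _ *+ n]mulr_natl => ->.
  congr (_ + _ / _); apply: eq_bigr => w _.
  by rewrite map_id ent_uniq // filter_uniq.
have l1 := lam_le_cent Sn0 pn0; have l2 := cent_le_lam Sn0 pn0.
rewrite -/(h n) in l1 l2.
pose F w := ln (size (fibre (p ^ n) (S n) w))%:R -
   c * (lam (addS (dil (q ^ J) (fibre (p ^ n) (S n) w)) Y) s0 - h J).
have [w wS hw] := exists_ge_avg F Sn0.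
exists (fibre (p ^ n) (S n) w); split.
- by rewrite filter_uniq.
- by rewrite size_filter -has_count; apply/hasP; exists w => //=.
- by move=> x; rewrite mem_filter => /andP[].
- exists ((p ^ n)%N%:Z * cell (p ^ n) w) => x; rewrite mem_filter => /andP[/eqP <- _].
  exact: cellP.
apply: (le_trans _ hw); rewrite /F sumrB -mulr_sumr sumrB mulrBl.
have -> : (\sum_(i <- S n) h J) = (size (S n))%:R * h J.
  by rewrite -(sum1_seq R) mulr_suml; under [RHS]eq_bigr do rewrite mul1r.
set A1 := (\sum_(y <- S n) ln _) in e1 *; set A2 := (\sum_(i <- S n) lam _ _) in H *.
have -> : c * (A2 - (size (S n))%:R * h J) / (size (S n))%:R =
    c * (A2 / (size (S n))%:R - h J).
  by field; rewrite pnatr_eq0 -lt0n.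
have h3 : A2 / (size (S n))%:R - h J <= h (n + J)%N - h n - h J + (ln 2%:R + ln (2 * M + 4)%:R).
  lra.
have := ler_wpM2l c0 h3; lra.
Qed.

End Fibres.

(** * Adding up entropy increments over the scales *)

Section Windows.
Variable R : realType.
Notation ent := (entropy R).
Notation lam := (scale_entropy R).
Notation inc := (scale_increment R).

(** By [gain_addS_le], no further copy of [B] adds more than the first one. *)
Lemma lam_sumS N (B Y : seq int) k : (0 < size B)%N -> (0 < size Y)%N -> (0 < k)%N ->
  lam (addS (sumS N B) Y) k <= lam Y k + N%:R * (lam (addS B Y) k - lam Y k).
Proof.
move=> B0 Y0 k0; elim: N => [|N IH].
  by rewrite mul0r addr0 /sumS /= (lam_perm R k (addSC _ _)) addS0.
have W0 : (0 < size (sumS N B))%N by rewrite size_sumS expn_gt0 B0.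
have := @gain_addS_le R _ (sumS N B) (addS Y (ints_below k)) B W0.
rewrite addS_gt0 ?size_U // => /(_ isT B0); rewrite /entropy_gain.
rewrite addSA (ent_addSC R _ B) (ent_addSC R _ B) !addSA -/(lam _ _).
rewrite -[addS B (sumS N B)]/(sumS N.+1 B) -natr1 mulrDl mul1r; rewrite /scale_entropy in IH *; lra.
Qed.

(** Each scale lies in at most [t] windows of [t] doublings: telescoping leaves the [t] lowest
    terms, each at most [lam Z s]. *)
Lemma sum_inc_le (Z : seq int) s E t : (0 < size Z)%N -> (0 < s)%N ->
  \sum_(0 <= j < E) inc Z (s * 2 ^ j) (2 ^ t) <= t%:R * lam Z s.
Proof.
move=> Z0 s0; have X0 j : (0 < 2 ^ j)%N by rewrite expn_gt0.
have k0 j : (0 < s * 2 ^ j)%N by rewrite muln_gt0 s0 X0.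
pose H j := lam Z (s * 2 ^ j).
have H0 j : 0 <= H j by exact: lam_ge0.
have Hle j : H j <= lam Z s.
  by have := inc_ge0 R Z0 s0 (X0 j); rewrite /scale_increment subr_ge0.
have -> : \sum_(0 <= j < E) inc Z (s * 2 ^ j) (2 ^ t) =
    \sum_(0 <= j < E) H j - \sum_(0 <= j < E) H (j + t)%N.
  by rewrite -sumrB; apply: eq_bigr => j _; rewrite /scale_increment /H expnD mulnA.
have e1 : \sum_(0 <= j < E + t) H j =
    \sum_(0 <= j < t) H j + \sum_(0 <= j < E) H (j + t)%N.
  rewrite (@big_cat_nat _ _ _ t) ?leq_addl //=; congr (_ + _).
  by rewrite -{1}[t]add0n big_addn addnK.
have e2 : \sum_(0 <= j < E) H j <= \sum_(0 <= j < E + t) H j.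
  by rewrite (@big_cat_nat _ _ _ E _ (E + t)) ?leq_addr //= lerDl sumr_ge0.
have e3 : \sum_(0 <= j < t) H j <= t%:R * lam Z s.
  apply: (@le_trans _ _ (\sum_(0 <= j < t) lam Z s)); first by apply: ler_sum.
  by rewrite sumr_const_nat subn0 mulr_natl.
lra.
Qed.

(** A Markov argument: values below [c1] contribute at most [c1 E] to the sum of the [c j], and the
    last [t] indices at most [t]; the rest bounds from below the number of [j] that earn the extra
    [rho]. *)
Lemma sum_threshold (c f : nat -> R) (E t : nat) (low rho c1 : R) :
  0 <= rho -> 0 <= c1 -> (forall j, c j <= 1) ->
  (forall j, (j < E - t)%N -> low <= f j) ->
  (forall j, (j < E - t)%N -> c1 <= c j -> low + rho <= f j) ->
  (E - t)%:R * low + rho * (\sum_(0 <= j < E) c j - c1 * E%:R - t%:R) <=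
  \sum_(0 <= j < E - t) f j.
Proof.
move=> rho0 c10 cle flow fhigh.
have h1 : \sum_(0 <= j < E - t) (low + rho * (c1 <= c j)%R%:R) <= \sum_(0 <= j < E - t) f j.
  rewrite big_nat [leRHS]big_nat; apply: ler_sum => j /andP[_ jE].
  by case: (boolP (c1 <= c j)) => hc; rewrite ?mulr1 ?mulr0 ?addr0; auto.
apply: le_trans h1; rewrite big_split /= sumr_const_nat subn0 -[low *+ _]mulr_natl lerD2l.
rewrite -mulr_sumr ler_wpM2l //.
have h2 : \sum_(0 <= j < E) c j <= \sum_(0 <= j < E) ((c1 <= c j)%R%:R + c1).
  by apply: ler_sum => j _; have := cle j; case: (leP c1 (c j)) => hc; rewrite ?mulr1n ?mulr0n; lra.
move: h2; rewrite big_split /= sumr_const_nat subn0 -[c1 *+ E]mulr_natr.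
have : \sum_(0 <= j < E) (c1 <= c j)%R%:R <=
    \sum_(0 <= j < E - t) (c1 <= c j)%R%:R + t%:R :> R.
  rewrite (@big_cat_nat _ _ _ (E - t)) ?leq_subr //= lerD2l.
  apply: (@le_trans _ _ (\sum_(E - t <= j < E) 1)).
    by apply: ler_sum => j _; rewrite lern1; case: (_ <= _).
  by rewrite sumr_const_nat ler_nat; lia.
lra.
Qed.

Variables (p q M : nat) (D : seq int).
Hypotheses (p0 : (0 < p)%N) (pq : (p < q)%N).
Hypotheses (D0 : (0 < size D)%N) (DM : {in D, forall d, `|d| <= M%:Z}).
Notation S := (cylinder_sums p q D).
Notation h := (cylinder_entropy R p q D).

(** The exponent [b] for [inc_S] is the least one with [(q/p)^b >= 2^j]. Minimality gives the upper
    bound up to the factor [q], and [J - a] being a candidate gives [a + b <= J]. *)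
Lemma inc_window n J E j t a : (j + t < E)%N -> (2 ^ E * p ^ J <= 2 * q ^ J)%N ->
  (q ^ a <= 2 ^ t * p ^ a)%N ->
  h a - (ln 2%:R + ln (2 * M * q + q + 1)%:R) <=
    inc (dil (p ^ n) (S J)) (p ^ (n + J) * 2 ^ j) (2 ^ t).
Proof.
move=> jtE hE ha; have q0 : (0 < q)%N by lia.
have P0 k : (0 < p ^ k)%N by rewrite expn_gt0 p0.
have Q0 k : (0 < q ^ k)%N by rewrite expn_gt0 q0.
(* The strict inequality [j + t < E] absorbs the factor 2. *)
have hE' : (2 ^ (j + t) * p ^ J <= q ^ J)%N.
  rewrite -(leq_pmul2l (ltn0Sn 1)); apply: leq_trans hE; rewrite mulnA -expnS.
  by rewrite leq_mul2r leq_exp2l // jtE orbT.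
have aJ : (a <= J)%N.
  rewrite leqNgt; apply/negP => Ja.
  have [d ad] : exists d, a = (J + d.+1)%N by exists (a - J).-1; lia.
  have : (q ^ J * q ^ d.+1 <= q ^ J * p ^ d.+1)%N.
    rewrite -expnD -ad; apply: (leq_trans ha); rewrite ad expnD mulnA leq_mul2r.
    apply/orP; right; apply: leq_trans hE'; rewrite leq_mul2r leq_exp2l //.
    by rewrite leq_addl orbT.
  by rewrite leq_pmul2l // leq_exp2r // leqNgt pq.
have exb : exists b, (2 ^ j * p ^ b <= q ^ b)%N.
  exists (J - a)%N; rewrite -(leq_pmul2r (Q0 a)) -expnD subnK //.
  apply: leq_trans hE'; rewrite -[in leqRHS](subnK aJ) !expnD.
  have := leq_mul (leqnn (2 ^ j * p ^ (J - a))%N) ha.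
  by move=> /leq_trans; apply; apply: eq_leq; ring.
case: (ex_minnP exb) => b hb bmin.
have bJ : (b <= J - a)%N.
  apply: bmin; rewrite -(leq_pmul2r (Q0 a)) -expnD subnK //.
  apply: leq_trans hE'; rewrite -[in leqRHS](subnK aJ) !expnD.
  have := leq_mul (leqnn (2 ^ j * p ^ (J - a))%N) ha.
  by move=> /leq_trans; apply; apply: eq_leq; ring.
have hb2 : (q ^ b <= q * (2 ^ j * p ^ b))%N.
  case: b hb bmin {bJ} => [|b] hb bmin.
    by rewrite !expn0; have : (0 < 2 ^ j)%N; rewrite ?expn_gt0 //; lia.
  have : ~~ (2 ^ j * p ^ b <= q ^ b)%N by apply/negP => /bmin; rewrite ltnn.
  rewrite -ltnNge => /ltnW hlt; rewrite [leqLHS]expnS leq_mul2l; apply/orP; right.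
  apply: (leq_trans hlt); rewrite leq_mul2l; apply/orP; right.
  by rewrite leq_pexp2l.
have abJ : (a + b <= J)%N by lia.
have := inc_S R p0 pq D0 DM abJ hb hb2 ha.
have -> : (p ^ (n + J) * 2 ^ j = p ^ n * (2 ^ j * p ^ J))%N by rewrite expnD; ring.
rewrite inc_dil ?S_gt0 ?expn_gt0 ?p0 //.
by rewrite muln_gt0 expn_gt0 P0.
Qed.

(** The balance over scales for the sum of [r 2^t] copies of [q^J B] and of [p^n S_J]: the latter
    guarantees [low] at every scale, the copies guarantee [low + rho] where the matched share is at
    least [c1], and the total is at most [t] times the entropy at scale [p^(n+J)]. *)
Lemma fibre_scales (B : seq int) (b0 : int) n J E g t a r (c1 low rho : R) :
  uniq B -> (0 < size B)%N ->
  {in B, forall x, b0 <= x < b0 + (p ^ n)%N%:Z} ->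
  (p ^ (n + J) <= q ^ J)%N ->
  (q ^ J <= 2 ^ E * p ^ J)%N -> (2 ^ E * p ^ J <= 2 * q ^ J)%N ->
  (0 < g)%N -> (2 ^ g + 2 <= 2 ^ t)%N -> (q ^ a <= 2 ^ t * p ^ a)%N ->
  0 <= c1 -> 0 <= rho -> low <= h a - (ln 2%:R + ln (2 * M * q + q + 1)%:R) ->
  low + rho <= (1 - (1 - (c1 / 2%:R) ^+ (2 ^ t)) ^+ r) *
     (ln (2 ^ t)%:R - ln (2 ^ g + 2)%:R) ->
  (E - t)%:R * low + rho * (ln (size B)%:R / ln 2%:R - g.+1%:R - 2%:R * E%:R / g%:R
      - c1 * E%:R - t%:R) <=
  t%:R * (h J + (r * 2 ^ t)%:R *
     (lam (addS (dil (q ^ J) B) (dil (p ^ n) (S J))) (p ^ (n + J)) - h J)).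
Proof.
move=> uB B0 BI s0q hE1 hE2 g0 gt ha c10 rho0 lowa lowr.
have q0 : (0 < q)%N by lia.
have P0 k : (0 < p ^ k)%N by rewrite expn_gt0 p0.
have Q0 k : (0 < q ^ k)%N by rewrite expn_gt0 q0.
have X0 j : (0 < 2 ^ j)%N by rewrite expn_gt0.
set s0 := (p ^ (n + J))%N in s0q *; set Y := dil _ (S J); set B' := dil (q ^ J) B.
have s00 : (0 < s0)%N by exact: P0.
have k0 j : (0 < s0 * 2 ^ j)%N by rewrite muln_gt0 s00 X0.
have uB' : uniq B' by rewrite map_inj_uniq // => x y; have := Q0 J; nia.
have B'0 : (0 < size B')%N by rewrite size_dil.
have Y0 : (0 < size Y)%N by rewrite size_dil S_gt0.
have [MT hMT] := @choice _ _ (fun (j : nat) (PT : seq (int * int) * seq int) =>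
   [/\ perm_eq B' (points PT.1 ++ PT.2), all (gap (s0 * 2 ^ j) (s0 * 2 ^ j * 2 ^ g)) PT.1 &
    {in PT.2 &, forall x y, ~~ gap (s0 * 2 ^ j) (s0 * 2 ^ j * 2 ^ g) (x, y)}])
  (fun j => let: ex_intro P (ex_intro T H) := maximal_matching (s0 * 2 ^ j * 2 ^ g) uB' (k0 j)
     in ex_intro _ (P, T) H).
pose c j : R := (2 * size (MT j).1)%:R / (size B')%:R.
(* Distinct integers multiplied by [q^J >= p^(n+J)]: at the bottom scale all points are
   separated. *)
have sep : {in B' &, forall x y, x < y -> s0%:Z <= y - x}.
  move=> _ _ /mapP[x xB ->] /mapP[y yB ->].
  have K0 : 0 < (q ^ J)%N%:Z by rewrite ltz_nat Q0.
  rewrite (ltr_pM2l K0) => xy; rewrite -mulrBr.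
  apply: (@le_trans _ _ (q ^ J)%N%:Z); first by rewrite lez_nat.
  by apply: ler_peMr; [exact: ltW|lia].
have int' : {in B', forall x, (q ^ J)%N%:Z * b0 <= x <
    (q ^ J)%N%:Z * b0 + (s0 * 2 ^ E)%N%:Z}.
  move=> _ /mapP[x /BI xB ->].
  have : (p ^ n * q ^ J <= s0 * 2 ^ E)%N.
    rewrite /s0 expnD -mulnA leq_mul2l (mulnC (p ^ J)%N) hE1 orbT //.
  move: xB (Q0 J); move: (p ^ n)%N (q ^ J)%N (s0 * 2 ^ E)%N => P Q W xB Q0' PQW; nia.
have hM1 j : perm_eq B' (points (MT j).1 ++ (MT j).2) by have [] := hMT j.
have hM2 j : {in (MT j).2 &, forall x y, ~~ gap (s0 * 2 ^ j) (s0 * 2 ^ j * 2 ^ g) (x, y)}.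
  by have [] := hMT j.
have := sum_matching R (M := fun j => (MT j).1) s00 g0 uB' B'0 sep int' hM1 hM2.
rewrite -/(\sum_(0 <= j < E) c j) => hsum.
have l2 : 0 < ln 2%:R :> R by rewrite ln_gt0 // ltr1n.
have gR : 0 < g%:R :> R by rewrite ltr0n.
have hX : ln (size B)%:R / ln 2%:R - g.+1%:R - 2%:R * E%:R / g%:R <=
    \sum_(0 <= j < E) c j.
  rewrite -(ler_pM2l (mulr_gt0 gR l2)).
  have -> : g%:R * ln 2%:R * (ln (size B)%:R / ln 2%:R - g.+1%:R - 2%:R * E%:R / g%:R) =
     g%:R * (ln (size B)%:R - g.+1%:R * ln 2%:R) - E%:R * (2%:R * ln 2%:R) :> R.
    by field; rewrite !gt_eqF.
  rewrite /B' size_dil in hsum; lra.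
have Z0 r' : (0 < size (addS (sumS r' B') Y))%N.
  by rewrite addS_gt0 // size_sumS expn_gt0 B'0.
have W0 r' : (0 < size (sumS r' B'))%N by rewrite size_sumS expn_gt0 B'0.
set Z := addS (sumS (r * 2 ^ t) B') Y.
have c_le1 j : c j <= 1.
  rewrite ler_pdivrMr ?ltr0n // mul1r ler_nat.
  by have [e _ _] := hMT j; rewrite (perm_size e) size_cat size_points leq_addr.
have fl j : (j < E - t)%N -> low <= inc Z (s0 * 2 ^ j) (2 ^ t).
  move=> jE; apply: (le_trans lowa).
  have jtE : (j + t < E)%N by rewrite addnC -ltn_subRL.
  by apply: le_trans (inc_window n jtE hE2 ha) _; apply: inc_addS.
have fh j : (j < E - t)%N -> c1 <= c j -> low + rho <= inc Z (s0 * 2 ^ j) (2 ^ t).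
  move=> jE cj; apply: (le_trans lowr).
  have [e1 e2 _] := hMT j.
  have gQ : ((2 ^ g).+2 <= 2 ^ t)%N by rewrite -addn2.
  have := inc_sumS_matching r (k0 j) gQ B'0 e1 e2 c10 cj.
  rewrite -(addn2 (2 ^ g)) => /le_trans; apply.
  by rewrite /Z (inc_perm R _ _ (addSC _ _)); apply: inc_addS.
have := sum_threshold rho0 c10 c_le1 fl fh.
have := sum_inc_le (E - t) t (Z0 (r * 2 ^ t)%N) s00.
have hY : lam Y s0 = h J by rewrite /Y /s0 expnD lam_dil ?S_gt0.
have := lam_sumS (r * 2 ^ t) B'0 Y0 s00; rewrite hY -/Z => z1 z2 z3.
have := ler_wpM2l (ler0n R t) z1.
have := ler_wpM2l rho0 hX.
lra.
Qed.

End Windows.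

(** * Choice of the constants and the bound for the growth rate *)

Lemma exists_nat_gt (R : realType) (x : R) : exists n : nat, x < n%:R.
Proof. by exists (Num.truncn x).+1; rewrite truncnS_gt. Qed.

Lemma exists_expr_le (R : realType) (x e : R) : 0 < x -> x <= 1 -> 0 < e ->
  exists r : nat, (1 - x) ^+ r <= e.
Proof.
move=> x0 x1 e0; have bern r : (1 - x) ^+ r * (1 + r%:R * x) <= 1.
  elim: r => [|r IH]; first by rewrite expr0 mul0r addr0 mulr1.
  have y0 : 0 <= (1 - x) ^+ r by rewrite exprn_ge0 // subr_ge0.
  have r0 : 0 <= r%:R :> R by [].
  rewrite exprSr -natr1; apply: le_trans IH.
  rewrite -mulrA ler_wpM2l //; nra.
have [r hr] := exists_nat_gt (e^-1 / x); exists r.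
rewrite ltr_pdivrMr // in hr.
have rx : 0 < 1 + r%:R * x by rewrite ltr_wpDr // mulr_ge0 // ltW.
have := bern r; rewrite -ler_pdivlMr // => /le_trans; apply.
rewrite div1r -[leRHS]invrK lef_pV2 ?posrE ?invr_gt0 //; lra.
Qed.

Lemma leq_ln (R : realType) (x y : nat) : (0 < y)%N -> ln x%:R <= ln y%:R :> R -> (x <= y)%N.
Proof.
case: x => // x y0; rewrite ler_ln ?posrE ?ltr0n // ler_nat //.
Qed.

Lemma ln_natX (R : realType) (x n : nat) : (0 < x)%N -> ln (x ^ n)%:R = n%:R * ln x%:R :> R.
Proof. by move=> x0; rewrite natrX lnXn ?ltr0n // mulr_natl. Qed.

Lemma expn2_add2 g : (2 ^ g + 2 <= 2 ^ (g + 2))%N.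
Proof. by rewrite expnD; have : (0 < 2 ^ g)%N; rewrite ?expn_gt0 //; lia. Qed.

Section Growth.
Variable R : realType.
Variables (p q M : nat) (D : seq int).
Hypotheses (p0 : (0 < p)%N) (pq : (p < q)%N).
Hypotheses (D0 : (0 < size D)%N) (DM : {in D, forall d, `|d| <= M%:Z}).
Hypothesis uniqS : forall n, uniq (cylinder_sums p q D n).
Notation S := (cylinder_sums p q D).
Notation h := (cylinder_entropy R p q D).
Notation lam := (scale_entropy R).
Let lnD : R := ln (size D)%:R.
Let beta : R := ln q%:R - ln p%:R.
Let l2 : R := ln 2%:R.

Lemma beta_gt0 : 0 < beta.
Proof. by rewrite subr_gt0 ltr_ln ?ltr_nat // posrE ltr0n // (leq_ltn_trans _ pq). Qed.

Lemma l2_gt0 : 0 < l2.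
Proof. by rewrite ln_gt0 // ltr1n. Qed.

(** The quantitative form of the [o(n)] bound: [Mc] times the excess is at most
    [ln (size B) <= n ln m], and [Mc] may be taken as large as desired before [n]. *)
Lemma exists_thick_fibre (alpha C Mc : R) (Ln : nat) :
  alpha < lnD -> 0 <= Mc ->
  (forall n, h n <= alpha * n%:R + C) ->
  (forall e, 0 < e -> exists2 K : R, 0 <= K & forall n, (alpha - e) * n%:R - K <= h n) ->
  exists n0 : nat, forall n, (n0 <= n)%N ->
  exists B : seq int, [/\ uniq B, (0 < size B)%N,
    exists a : int, {in B, forall x, a <= x < a + (p ^ n)%N%:Z},
    n%:R * (lnD - alpha) / 2%:R <= ln (size B)%:R &
    Mc * (lam (addS (dil (q ^ (Ln * n)) B) (dil (p ^ n) (S (Ln * n)))) (p ^ (n + Ln * n))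
       - h (Ln * n)%N) <= n%:R * lnD].
Proof.
move=> aD Mc0 hup hlow.
set d := lnD - alpha; have d0 : 0 < d by rewrite subr_gt0.
(* The slope error [d / w], incurred at [n] and at [Ln * n] and weighted by [Mc], costs at most
   [d n / 4]; the choice of [n0] keeps the constants within another [d n / 4]. *)
pose w := 4%:R * (Mc + 1) * (1 + Ln%:R).
have w0 : 0 < w by rewrite !mulr_gt0 // ?ltr_wpDl // ltr_wpDr.
have [K K0 hK] := hlow (d / w) (divr_gt0 d0 w0).
pose C1 : R := ln 2%:R + ln (2 * M + 4)%:R.
have [n0 hn0] := exists_nat_gt ((C + l2 + Mc * (C + 2%:R * K + C1)) / (d / 4%:R)).
exists n0 => n n0n.
have [B [uB B0 BS [a Ba] hB]] := @exists_fibre R p q M D p0 pq D0 DM uniqS n (Ln * n) Mc Mc0.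
set G := lam _ _ - h _ in hB *.
have G0 : 0 <= G.
  rewrite subr_ge0 /cylinder_entropy -(lam_dil R (c := p ^ n)) ?S_gt0 ?expn_gt0 ?p0 //.
  rewrite -expnD; apply: lam_addl; rewrite ?size_dil ?S_gt0 ?expn_gt0 ?p0 //.
have BD : ln (size B)%:R <= n%:R * lnD.
  rewrite -ln_natX // -(size_S p q D n); apply: ler_ln_nat; exact: uniq_leq_size.
have n1 : C + l2 + Mc * (C + 2%:R * K + C1) <= n%:R * (d / 4%:R).
  rewrite -ler_pdivrMr ?divr_gt0 //; apply: ltW; apply: (lt_le_trans hn0).
  by rewrite ler_nat.
have key : n%:R * d / 2%:R <= ln (size B)%:R - Mc * G.
  apply: le_trans hB; rewrite -/C1 -/lnD.
  have h1 := hup n; have h2 := hup (n + Ln * n)%N; have h3 := hK n; have h4 := hK (Ln * n)%N.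
  rewrite natrD natrM in h2; rewrite natrM in h4.
  have e1 : d / w * (1 + Ln%:R) * Mc <= d / 4%:R.
    have -> : d / w * (1 + Ln%:R) * Mc = d / 4%:R * (Mc / (Mc + 1)).
      by rewrite /w; field; rewrite !gt_eqF //; rewrite ?ltr_wpDl // ltr_wpDr.
    apply: ler_piMr; first by rewrite divr_ge0 // ltW.
    have Mc1 : 0 < Mc + 1 by rewrite ltr_wpDl.
    by rewrite ler_pdivrMr // mul1r lerDl.
  have h5 : h (n + Ln * n)%N - h n - h (Ln * n)%N + C1 <=
      C + 2%:R * K + C1 + d / w * (1 + Ln%:R) * n%:R by lra.
  have h6 := ler_wpM2l Mc0 h5.
  have h7 := ler_wpM2r (ler0n R n) e1.
  have : n%:R * d = n%:R * lnD - alpha * n%:R by rewrite /d; ring.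
  rewrite -/l2; lra.
exists B; split => //.
- by exists a.
- apply: (le_trans key); rewrite gerBl mulr_ge0 //.
- have : 0 <= n%:R * d / 2%:R by rewrite !mulr_ge0 // ltW.
  rewrite -/G; lra.
Qed.

End Growth.

(** The constants are fixed in the order [Ln], [c1], [g], [eps], [t], [r], [Mc], [n], each depending
    only on earlier ones. In units of [t n om], the branching scales gain [1/4], while the losses
    are [1/16] in [low], [1/32] from the excess and less than [1/8] from bounded terms: a
    contradiction. *)
Lemma growth_rate_ge (R : realType) (p q M : nat) (D : seq int) (alpha C : R) :
  (0 < p)%N -> (p < q)%N -> (0 < size D)%N -> {in D, forall d, `|d| <= M%:Z} ->
  (forall n, uniq (cylinder_sums p q D n)) -> 0 <= alpha ->
  (forall n, cylinder_entropy R p q D n <= alpha * n%:R + C) ->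
  (forall e, 0 < e ->
    exists2 K : R, 0 <= K & forall n, (alpha - e) * n%:R - K <= cylinder_entropy R p q D n) ->
  Num.min (ln (size D)%:R) (ln q%:R - ln p%:R) <= alpha.
Proof.
move=> p0 pq D0 DM uniqS a0 hup hlow.
have b0 := beta_gt0 R p0 pq; have l0 := l2_gt0 R.
set lnD := ln (size D)%:R; set beta := ln q%:R - ln p%:R in b0 *; set l2 := ln 2%:R in l0.
rewrite leNgt lt_min; apply/negP => /andP[aD ab].
set d := lnD - alpha; have d0 : 0 < d by rewrite subr_gt0.
have bn : beta != 0 by rewrite gt_eqF.
have ln_ : l2 != 0 by rewrite gt_eqF.
(* The relative shortfall from the full rate: one doubling of the scale accounts for about
   [(1 - tau) ln 2] of the entropy of [p^n S_J]. *)
pose tau := 1 - alpha / beta.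
have tau0 : 0 < tau by rewrite subr_gt0 ltr_pdivrMr // mul1r.
have ab1 : 0 <= alpha / beta by rewrite divr_ge0 // ltW.
have tauE : alpha / beta = 1 - tau by rewrite /tau; ring.
(* With [J = Ln * n] this gives [p^(n+J) <= q^J]. *)
have [Ln hLn] := exists_nat_gt (ln p%:R / beta).
rewrite ltr_pdivrMr // in hLn.
(* [E1 n] will bound the number [E] of doublings between the bottom scale and the whole span. *)
pose E1 : R := Ln%:R * beta / l2 + 1.
have E10 : 1 <= E1 by rewrite lerDr divr_ge0 ?mulr_ge0 // ltW.
have E1n : 0 < E1 by lra.
have E1E : E1 = Ln%:R * beta / l2 + 1 by [].
clearbody E1.
(* The bound [ln (size B) >= n d / 2] amounts to [2 kap n] doublings. Three losses of at most
   [kap n / 2], controlled by [g], [c1] and [n], leave [kap n / 2] for the branching scales. *)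
pose kap := d / (4%:R * l2); have k0 : 0 < kap by rewrite divr_gt0 ?mulr_gt0.
have kE : kap * (4%:R * l2) = d.
  by rewrite /kap divfK // mulf_neq0 // gt_eqF.
clearbody kap.
pose c1 := Num.min (kap / (2%:R * E1)) 1.
have c10 : 0 < c1 by rewrite lt_min ltr01 andbT; apply: divr_gt0 => //; apply: mulr_gt0.
have c1k : c1 * E1 <= kap / 2%:R.
  apply: (@le_trans _ _ (kap / (2%:R * E1) * E1)); last first.
    by rewrite le_eqVlt; apply/orP; left; apply/eqP; field; rewrite gt_eqF.
  by apply: ler_wpM2r; rewrite ?ge_min ?lexx // ltW.
pose om := kap * l2 * tau; have om0 : 0 < om by apply: mulr_gt0 => //; apply: mulr_gt0.
have omE : om = kap * l2 * tau by [].
clearbody om.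
have [g hg] := exists_nat_gt (16%:R * E1 * l2 / d).
rewrite ltr_pdivrMr // in hg.
have g0 : (0 < g)%N.
  by rewrite -(ltr0n R) -(pmulr_lgt0 _ d0); apply: le_lt_trans hg; rewrite !mulr_ge0 // ltW.
pose eps := om * beta / (32%:R * E1 * l2).
have eps0 : 0 < eps by apply: divr_gt0; apply: mulr_gt0 => //; apply: mulr_gt0.
have epsE : eps * (32%:R * E1 * l2) = om * beta.
  by rewrite /eps divfK // !mulf_neq0 ?gt_eqF.
clearbody eps.
have [K K0 hK] := hlow eps eps0.
pose C2 : R := ln 2%:R + ln (2 * M * q + q + 1)%:R.
have C20 : 0 <= C2 by rewrite addr_ge0 ?ln_nat_ge0.
pose C3 := alpha + K + C2; have C30 : 0 <= C3 by apply: addr_ge0 => //; apply: addr_ge0.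
(* The window is so long that the chain loss [ln (2^g + 2) <= (g + 2) ln 2] is at most a quarter of
   [t tau ln 2], and that the constant [C3], paid at every scale, is small against [t om]. *)
have [t ht] := exists_nat_gt (4%:R * (g%:R + 2%:R) / tau + 32%:R * C3 * E1 / om + g%:R + 2%:R).
have [ht1 ht2 ht3] : [/\ 4%:R * (g%:R + 2%:R) <= t%:R * tau, 32%:R * C3 * E1 <= t%:R * om &
    (g + 2 <= t)%N].
  have x1 : 0 <= 4%:R * (g%:R + 2%:R) / tau by rewrite !mulr_ge0 ?invr_ge0 // ltW.
  have x2 : 0 <= 32%:R * C3 * E1 / om by rewrite !mulr_ge0 ?invr_ge0 // ltW.
  have x3 : 0 <= g%:R :> R by [].
  split; first by rewrite -ler_pdivrMr //; move: ht x1 x2 x3; clear; lra.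
    by rewrite -ler_pdivrMr //; move: ht x1 x2 x3; clear; lra.
  by rewrite -(ler_nat R) natrD; move: ht x1 x2 x3; clear; lra.
have t0 : 0 < t%:R :> R by rewrite ltr0n; apply: leq_trans ht3; rewrite addn2.
pose a := Num.truncn (t%:R * l2 / beta).
have [ha1 ha2] : a%:R * beta <= t%:R * l2 /\ t%:R * l2 < (a%:R + 1) * beta.
  have x0 : 0 <= t%:R * l2 / beta by rewrite !mulr_ge0 ?invr_ge0 // ltW.
  have /andP[] := truncn_itv x0; rewrite -/a ler_pdivlMr // ltr_pdivrMr // -natr1.
  by [].
pose x := (c1 / 2%:R) ^+ (2 ^ t).
have c11 : c1 <= 2%:R by rewrite ge_min ler1n orbT.
have x0 : 0 < x by rewrite exprn_gt0 // divr_gt0.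
have x1 : x <= 1.
  by apply: exprn_ile1; [rewrite divr_ge0 // ltW|rewrite ler_pdivrMr // mul1r].
have [r hr] := @exists_expr_le R x (tau / 4%:R) x0 x1 (divr_gt0 tau0 (ltr0n _ 4)).
pose N : R := (r * 2 ^ t)%:R.
have lnD0 : 0 < lnD by exact: le_lt_trans aD.
have N0 : 0 <= N by [].
(* This makes [N] times the excess at most [n om / 32]. *)
pose Mc := 32%:R * N * lnD / om; have Mc0 : 0 <= Mc by rewrite !mulr_ge0 ?invr_ge0 // ltW.
have [n0 hn0] := exists_thick_fibre p0 pq D0 DM uniqS Ln aD Mc0 hup hlow.
have [n1 hn1] := exists_nat_gt ((g.+1%:R + t%:R) * 2%:R / kap + (t%:R * l2 + C) * 8%:R / om).
pose n := (maxn n0 (maxn n1 1)).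
have [n_0 n_1 n_2] : [/\ (n0 <= n)%N, (n1 <= n)%N & (1 <= n)%N] by rewrite /n; split; rewrite !leq_max leqnn ?orbT.
have [B [uB B0 [b0' Bb] hB hG]] := hn0 n n_0.
set J := (Ln * n)%N in hG.
set G := scale_entropy R _ _ - cylinder_entropy R p q D _ in hG.
have C0 : 0 <= C by have := hup 0%N; rewrite mulr0 add0r; apply: le_trans; exact: h_ge0.
have [hn2 hn3] : (g.+1%:R + t%:R) <= n%:R * (kap / 2%:R) /\
    t%:R * l2 + C < n%:R * (om / 8%:R).
  have n1n : n1%:R <= n%:R :> R by rewrite ler_nat.
  have y1 : 0 <= (g.+1%:R + t%:R) * 2%:R / kap by rewrite !mulr_ge0 ?invr_ge0 ?addr_ge0 // ltW.
  have y2 : 0 <= (t%:R * l2 + C) * 8%:R / om.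
    by rewrite !mulr_ge0 ?invr_ge0 ?addr_ge0 ?mulr_ge0 // ltW.
  split.
    rewrite -ler_pdivrMr ?divr_gt0 // invf_div mulrA; move: hn1 n1n y1 y2; clear; lra.
  rewrite -ltr_pdivrMr ?divr_gt0 // invf_div mulrA; move: hn1 n1n y1 y2; clear; lra.
have NG : N * G <= n%:R * (om / 32%:R).
  have -> : N * G = Mc * G * (om / (32%:R * lnD)) by rewrite /Mc; field; rewrite !gt_eqF.
  have -> : n%:R * (om / 32%:R) = n%:R * lnD * (om / (32%:R * lnD)) by field; rewrite gt_eqF.
  by rewrite ler_pM2r // divr_gt0 // mulr_gt0.
pose E := (Num.truncn (J%:R * beta / l2)).+1.
have [hE1 hE2] : J%:R * beta <= E%:R * l2 /\ E%:R * l2 <= J%:R * beta + l2.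
  have y0 : 0 <= J%:R * beta / l2 by rewrite !mulr_ge0 ?invr_ge0 // ltW.
  have /andP[] := truncn_itv y0; rewrite ler_pdivlMr // ltr_pdivrMr // -/E => z1 z2.
  by split; [exact: ltW|rewrite /E -natr1 mulrDl mul1r lerD2r].
have EE1 : E%:R <= n%:R * E1.
  rewrite -(ler_pM2r l0); apply: (le_trans hE2).
  have -> : n%:R * E1 * l2 = J%:R * beta + n%:R * l2.
    by rewrite E1E /J natrM; field.
  by rewrite lerD2l ler_peMl ?ler1n // ltW.
have q0 : (0 < q)%N by exact: leq_ltn_trans pq.
have X0 k : (0 < 2 ^ k)%N by rewrite expn_gt0.
have P0 k : (0 < p ^ k)%N by rewrite expn_gt0 p0.
have Q0 k : (0 < q ^ k)%N by rewrite expn_gt0 q0.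
have f1 : (p ^ (n + J) <= q ^ J)%N.
  apply: (leq_ln (R := R)) => //; rewrite !ln_natX // natrD.
  have := ler_wpM2l (ler0n R n) (ltW hLn); rewrite /J natrM /beta; clear; lra.
have f2 : (q ^ J <= 2 ^ E * p ^ J)%N.
  apply: (leq_ln (R := R)); rewrite ?muln_gt0 ?X0 ?P0 // ln_natM // !ln_natX //.
  move: hE1; rewrite /beta /l2; clear; lra.
have f3 : (2 ^ E * p ^ J <= 2 * q ^ J)%N.
  apply: (leq_ln (R := R)); rewrite ?muln_gt0 ?Q0 // !ln_natM // !ln_natX //.
  move: hE2; rewrite /beta /l2; clear; lra.
have f4 : (2 ^ g + 2 <= 2 ^ t)%N.
  have : (2 ^ (g + 2) <= 2 ^ t)%N by rewrite leq_exp2l.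
  apply: leq_trans; exact: expn2_add2.
have f5 : (q ^ a <= 2 ^ t * p ^ a)%N.
  apply: (leq_ln (R := R)); rewrite ?muln_gt0 ?X0 ?P0 // ln_natM // !ln_natX //.
  move: ha1; rewrite /beta /l2; clear; lra.
pose T := t%:R * l2; have T0 : 0 < T by rewrite mulr_gt0.
(* [rho] is half of the shortfall [T tau]; the two remaining quarters pay for the mass outside the
   chains and for [ln (2^g + 2)]. *)
pose low := T * (alpha - eps) / beta - C3; pose rho := T * tau / 2%:R.
have rho0 : 0 <= rho by rewrite !mulr_ge0 // ltW.
have lowa : low <= cylinder_entropy R p q D a - C2.
  have := hK a; rewrite /low /C3.
  set y := T / beta; have -> : T * (alpha - eps) / beta = (alpha - eps) * y by rewrite /y; field.
  have y1 : a%:R <= y by rewrite ler_pdivlMr.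
  have y2 : y <= a%:R + 1 by rewrite ler_pdivrMr // ltW.
  have := ler_wpM2l a0 y2; have := ler_wpM2l (ltW eps0) y1; rewrite /C3; clear; lra.
have lowr : low + rho <= (1 - (1 - (c1 / 2%:R) ^+ (2 ^ t)) ^+ r) *
     (ln (2 ^ t)%:R - ln (2 ^ g + 2)%:R).
  rewrite -/x ln_natX // -/l2 -/T; set eta := (1 - x) ^+ r in hr *.
  have eta0 : 0 <= eta by rewrite exprn_ge0 // subr_ge0.
  set G2 := ln (2 ^ g + 2)%:R; have G20 : 0 <= G2 by exact: ln_nat_ge0.
  have G2T : G2 <= T * tau / 4%:R.
    apply: (@le_trans _ _ ((g%:R + 2%:R) * l2)); last first.
      by have := ler_wpM2r (ltW l0) ht1; rewrite /T; clear; lra.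
    rewrite -natrD /l2 -ln_natX //; exact: ler_ln_nat (expn2_add2 g).
  have e1 : T * (alpha - eps) / beta <= T * (1 - tau).
    rewrite -tauE -mulrA; apply: ler_wpM2l; first exact: ltW.
    by apply: ler_wpM2r; [rewrite invr_ge0 ltW|rewrite gerBl ltW].
  have e2 := ler_wpM2r (ltW T0) hr; have e3 := mulr_ge0 eta0 G20.
  move: e1 e2 e3 G2T C30; rewrite /low /rho; clear; lra.
have := fibre_scales p0 pq D0 DM uB B0 Bb f1 f2 f3 g0 f4 f5 (ltW c10) rho0 lowa lowr.
rewrite -/G -/N -/l2.
set Xr := ln _ / _ - _ - _ - _ - _ => main.
have hX : n%:R * kap / 2%:R <= Xr.
  have x2 : n%:R * (2%:R * kap) <= ln (size B)%:R / l2.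
    rewrite ler_pdivlMr //; apply: le_trans hB; rewrite -/d -kE; clear; lra.
  have gR : 0 < g%:R :> R by rewrite ltr0n.
  have x3 : 2%:R * E%:R / g%:R <= n%:R * kap / 2%:R.
    rewrite ler_pdivrMr //.
    have hg' : 4%:R * E1 <= g%:R * kap.
      rewrite -(ler_pM2r (mulr_gt0 (ltr0n R 4) l0)) -[leRHS]mulrA kE; move: hg; clear; lra.
    have := ler_wpM2l (ler0n R n) hg'; move: EE1; clear; lra.
  have x4 : c1 * E%:R <= n%:R * kap / 2%:R.
    have := ler_wpM2l (ltW c10) EE1; have := ler_wpM2l (ler0n R n) c1k; clear; lra.
  rewrite /Xr; move: x2 x3 x4 hn2; clear; lra.
(* The sign of [low] is unknown; if it is negative, dropping the last [t] scales costs nothing. *)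
have hlowE : E%:R * low - t%:R * T <= (E - t)%:R * low.
  have lowT : low <= T.
    have : T * (alpha - eps) / beta <= T.
      rewrite ler_pdivrMr //; apply: ler_wpM2l; first exact: ltW.
      move: ab eps0; clear; lra.
    move: C30; rewrite /low; clear; lra.
  have [low0|low0] := leP 0 low.
    have : E%:R - t%:R <= (E - t)%:R :> R.
      by rewrite lerBlDr -natrD ler_nat addnC -leq_subLR.
    move=> /(ler_wpM2r low0); have := ler_wpM2l (ler0n R t) lowT; clear; lra.
  have : (E - t)%:R <= E%:R :> R by rewrite ler_nat leq_subr.
  move=> /(ler_wnM2r (ltW low0)); have := mulr_ge0 (ltW t0) (ltW T0); clear; lra.
have hElow : t%:R * (alpha * J%:R) - t%:R * n%:R * om / 16%:R <= E%:R * low.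
  have x2 : t%:R * (alpha * J%:R) <= E%:R * (T * alpha / beta).
    have -> : E%:R * (T * alpha / beta) = t%:R * (alpha * (E%:R * l2 / beta)).
      by rewrite /T; field.
    by rewrite ler_pM2l // ler_wpM2l // ler_pdivlMr.
  have x3 : E%:R * (T * eps / beta) <= t%:R * n%:R * om / 32%:R.
    have -> : t%:R * n%:R * om / 32%:R = n%:R * E1 * (T * eps / beta).
      have -> : om = eps * (32%:R * E1 * l2) / beta by rewrite epsE mulfK.
      by rewrite /T; field.
    by rewrite ler_wpM2r // !mulr_ge0 ?invr_ge0 // ltW.
  have x4 : C3 * E%:R <= t%:R * n%:R * om / 32%:R.
    have := ler_wpM2l C30 EE1; have := ler_wpM2l (ler0n R n) ht2; clear; lra.
  have -> : E%:R * low = E%:R * (T * alpha / beta) - E%:R * (T * eps / beta) - C3 * E%:R.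
    by rewrite /low; field.
  move: x2 x3 x4; clear; lra.
have hrho := ler_wpM2l rho0 hX.
have hJ := hup J.
have : rho * (n%:R * kap / 2%:R) = t%:R * (n%:R * (om / 4%:R)).
  by rewrite /rho /T omE; field.
have hfin : t%:R * (cylinder_entropy R p q D J + N * G) <= t%:R * (alpha * J%:R + C + n%:R * (om / 32%:R)).
  by rewrite ler_pM2l //; move: hJ NG; clear; lra.
have : t%:R * (T + C) < t%:R * (n%:R * (om / 8%:R)) by rewrite ltr_pM2l.
have : 0 <= t%:R * (n%:R * om) by rewrite !mulr_ge0 // ltW.
move: main hlowE hElow hrho hfin; clear; lra.
Qed.

(** * Covering numbers and box dimension *)

Section CoveringNumber.
Variable R : realType.
Implicit Types (Y : set R) (e : R).

Lemma coverable_nat e Y n (V : nat -> set R) :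
  (forall k, (k < n)%N -> diam_le e (V k)) ->
  (forall y, Y y -> exists2 k, (k < n)%N & V k y) -> coverable e Y n.
Proof.
move=> Vd VY; exists (fun k : 'I_n => V k); split; first by move=> k; exact: Vd.
by move=> y /VY[k kn Vy]; exists (Ordinal kn).
Qed.

(** Once some finite cover exists the minimum is attained, so the default value of [xget] does not
    occur. *)
Lemma covering_numberP e Y n : coverable e Y n ->
  coverable e Y (covering_number e Y) /\
  forall m, coverable e Y m -> (covering_number e Y <= m)%N.
Proof.
move=> cn; rewrite /covering_number; case: xgetP => [k _ []//|H].
exfalso; have ex : exists n, `[< coverable e Y n >] by exists n; apply/asboolP.
case: (ex_minnP ex) => m /asboolP cm mmin.
by apply: (H m); split => // k /asboolP; apply: mmin.
Qed.

Lemma coverable_interval e Y (b : R) n : 0 < e -> (forall y, Y y -> `|y| <= b) ->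
  2%:R * b <= n%:R * e -> coverable e Y n.+1.
Proof.
move=> e0 Yb bn; pose V (k : nat) : set R := [set y | - b + k%:R * e <= y <= - b + k.+1%:R * e].
apply: (coverable_nat (V := V)).
  move=> k _ x y; rewrite /V /= -natr1 => /andP[x1 x2] /andP[y1 y2].
  by rewrite ler_norml; apply/andP; split; lra.
move=> y /Yb; rewrite ler_norml => /andP[y1 y2].
have z0 : 0 <= (y + b) / e by apply: divr_ge0; [lra|exact: ltW].
pose k := Num.truncn ((y + b) / e).
have /andP[k1 k2] := truncn_itv z0; rewrite -/k in k1 k2.
rewrite ler_pdivlMr // in k1; rewrite ltr_pdivrMr // in k2.
exists k; last by rewrite /V /=; apply/andP; split; lra.
rewrite -(ltr_nat R) -(ltr_pM2r e0); apply: (le_lt_trans k1).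
by rewrite -natr1 mulrDl mul1r; lra.
Qed.

End CoveringNumber.

Section Words.
Variable R : realType.
Variable L : finType.
Variables (p q c : nat) (d : L -> int).
Hypotheses (p0 : (0 < p)%N) (pq : (p < q)%N) (c0 : (0 < c)%N).
Let rr : R := p%:R / q%:R.
Let f (i : L) : R -> R := fun x => rr * x + (d i)%:~R / c%:R.

(** Letters are appended at the end, to match the recursion of [cylinder_sums]. *)
Fixpoint words (n : nat) : seq (seq L) :=
  if n is n'.+1 then [seq rcons w i | w <- words n', i <- enum L] else [:: [::]].

(** The integer for which [f_w(0)] is [q * word_val w / (c * q ^ size w)], as [word_mapE] shows. *)
Fixpoint word_val (w : seq L) : int :=
  if w is i :: w' then (q ^ size w')%N%:Z * d i + p%:Z * word_val w' else 0.

Lemma word_val_rcons w i :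
  word_val (rcons w i) = q%:Z * word_val w + (p ^ size w)%N%:Z * d i.
Proof.
elim: w => [|j w IH] /=; first by rewrite !expn0 !mulr0 addr0 add0r.
by rewrite IH size_rcons !expnS !PoszM; ring.
Qed.

Lemma size_words_mem n w : w \in words n -> size w = n.
Proof.
elim: n w => [|n IH] w; first by rewrite inE => /eqP ->.
by move=> /allpairsP[[u i] [/= /IH su _ ->]]; rewrite size_rcons su.
Qed.

Lemma word_vals n : [seq word_val w | w <- words n] = cylinder_sums p q [seq d i | i <- enum L] n.
Proof.
elim: n => //= n IH; rewrite map_allpairs -IH /addS /dil !allpairs_mapl !allpairs_mapr; apply/eq_in_allpairs => w i /size_words_mem sw _.
by rewrite word_val_rcons sw.
Qed.

Lemma uniq_words n : uniq (words n).
Proof.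
elim: n => //= n IH; apply: allpairs_uniq => //; first exact: enum_uniq.
by move=> [u i] [w j] _ _ /= /rcons_inj[-> ->].
Qed.

Lemma size_words n : size (words n) = (#|L| ^ n)%N.
Proof. by elim: n => //= n IH; rewrite size_allpairs IH -cardE expnSr. Qed.

Lemma word_mapE w x : word_map f w x =
  rr ^+ size w * x + q%:R * (word_val w)%:~R / (c%:R * q%:R ^+ size w).
Proof.
have q0 : (0 < q)%N by exact: leq_ltn_trans pq.
have qn : q%:R != 0 :> R by rewrite pnatr_eq0 -lt0n.
have cn : c%:R != 0 :> R by rewrite pnatr_eq0 -lt0n.
elim: w => [|i w IH] /=; first by rewrite mul1r mulr0 mul0r addr0.
have e1 : rr ^+ (size w).+1 = rr * rr ^+ size w by rewrite exprS.
rewrite e1 /f IH intrD !intrM -!pmulrn natrX [q%:R ^+ (size w).+1]exprS /rr; field.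
by rewrite expf_neq0 ?qn ?cn.
Qed.

Hypothesis no_overlap : ~ exact_overlaps f.

(** Maps of words of the same length have the same slope, so two words with equal values would form
    an exact overlap. *)
Lemma uniq_S n : uniq (cylinder_sums p q [seq d i | i <- enum L] n).
Proof.
rewrite -word_vals map_inj_in_uniq ?uniq_words // => u w uW wW uw.
have su := size_words_mem uW; have sw := size_words_mem wW.
apply: contrapT => neq; apply: no_overlap.
exists n, (Tuple (introT eqP su)), (Tuple (introT eqP sw)); split.
  by move=> /(congr1 val).
by apply/funext => x; rewrite !word_mapE /= su sw uw.
Qed.

Variable X : set R.
Hypothesis XX : self_similar_set f X.

Lemma word_map_rcons w i x : word_map f (rcons w i) x = word_map f w (f i x).
Proof. by elim: w => //= j w ->. Qed.

Lemma self_similar_word w x : X x -> X (word_map f w x).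
Proof.
case: XX => _ _ XE; move=> Xx; elim: w => //= i w IH.
by rewrite XE; exists i => //; exists (word_map f w x).
Qed.

Lemma self_similar_words n x : X x -> exists2 w, w \in words n & exists2 y, X y & x = word_map f w y.
Proof.
case: XX => _ _ XE; elim: n x => [|n IH] x Xx; first by exists [::] => //; exists x.
have [w wW [y + ->]] := IH x Xx; rewrite {1}XE => -[i _ [z Xz <-]].
exists (rcons w i); first by apply/allpairsP; exists (w, i); rewrite /= mem_enum.
by exists z => //; rewrite word_map_rcons.
Qed.

Lemma rr_gt0 : 0 < rr.
Proof. by rewrite divr_gt0 // ltr0n // (leq_ltn_trans _ pq). Qed.

Lemma coverable_words e n (b : R) : (forall y, X y -> `|y| <= b) ->
  2%:R * b * rr ^+ n <= e -> coverable e X (#|L| ^ n)%N.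
Proof.
move=> Xb be; rewrite -size_words.
apply: (coverable_nat (V := fun k => word_map f (nth [::] (words n) k) @` X)).
  move=> k kn _ _ [x Xx <-] [y Xy <-]; rewrite !word_mapE.
  rewrite (size_words_mem (mem_nth _ kn)) opprD addrACA subrr addr0 -mulrBr normrM.
  have rn0 : 0 <= rr ^+ n by rewrite exprn_ge0 // ltW // rr_gt0.
  apply: le_trans be; rewrite mulrC (ger0_norm rn0); apply: ler_wpM2r => //.
  apply: (le_trans (ler_normB _ _)); have := Xb x Xx; have := Xb y Xy; lra.
move=> y /(self_similar_words n)[w wW [z Xz ->]].
by exists (index w (words n)); rewrite ?index_mem // nth_index //; exists z.
Qed.

(* The points [f_w x0] lying in one set of diameter at most [r^n] come from
   values [word_val w] in a window of length [O(p^n)]. *)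
Lemma h_le_coverable e n N : e <= rr ^+ n -> coverable e X N ->
  cylinder_entropy R p q [seq d i | i <- enum L] n <= ln N%:R + ln (2 * c + 2)%:R.
Proof.
move=> en [V [Vd VX]]; case: XX => -[x0 Xx0] _ _.
have q0 : (0 < q)%N by exact: leq_ltn_trans pq.
have qn : q%:R != 0 :> R by rewrite pnatr_eq0 -lt0n.
have cn : c%:R != 0 :> R by rewrite pnatr_eq0 -lt0n.
have P0 : (0 < p ^ n)%N by rewrite expn_gt0 p0.
set D := [seq d i | i <- enum L].
pose Q (k : 'I_N) (v : int) := exists2 w, w \in words n & word_val w = v /\ V k (word_map f w x0).
have ex k : exists gk : int, forall v, Q k v -> `|v - gk| <= (c * p ^ n)%N%:Z.
  have [[v0 Qv0]|no] := pselect (exists v, Q k v); last first.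
    by exists 0 => v Qv; exfalso; apply: no; exists v.
  exists v0 => _ [w wW [<- Vw]]; case: Qv0 => u uW [<- Vu].
  have := Vd k _ _ Vw Vu; rewrite !word_mapE !(size_words_mem wW) !(size_words_mem uW).
  set t := (_ - _) => /le_trans /(_ en) ht.
  have tE : t * (c%:R * q%:R ^+ n) = q%:R * (word_val w - word_val u)%:~R.
    by rewrite /t intrD mulrNz; field; rewrite expf_neq0.
  have : `|(word_val w - word_val u)%:~R : R| <= (c * p ^ n)%N%:R.
    have cq : 0 < c%:R * q%:R ^+ n :> R by rewrite mulr_gt0 ?exprn_gt0 ?ltr0n.
    have h1 : `|t| * (c%:R * q%:R ^+ n) <= (c * p ^ n)%N%:R.
      apply: (@le_trans _ _ (rr ^+ n * (c%:R * q%:R ^+ n))); first by rewrite ler_pM2r.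
      by rewrite /rr expr_div_n natrM natrX le_eqVlt; apply/orP; left; apply/eqP; field;
        rewrite expf_neq0.
    apply: le_trans h1; rewrite -[X in _ * X](gtr0_norm cq) -normrM tE normrM.
    by rewrite ler_peMl // ger0_norm // ler1n.
  by rewrite -intr_norm pmulrn ler_int.
have [g hg] := choice ex.
(* Values within [c p^n] of [g k], moved up by less than [p^n], fit into a window of [(2 c + 2) p^n]
   integers. *)
pose W (k : 'I_N) := [seq (g k - (c * p ^ n)%N%:Z) + i | i <- ints_below ((2 * c + 2) * p ^ n)].
have hS : {subset addS (cylinder_sums p q D n) (ints_below (p ^ n)) <= flatten [seq W k | k <- enum 'I_N]}.
  move=> _ /allpairsP[[v i] [/= + iU ->]]; rewrite -word_vals => /mapP[w wW ->].
  have [k _ Vk] := VX _ (self_similar_word w Xx0).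
  have Qk : Q k (word_val w) by exists w.
  apply/flattenP; exists (W k); first by apply/mapP; exists k; rewrite // mem_enum.
  apply/mapP; exists (word_val w + i - (g k - (c * p ^ n)%N%:Z)); last by rewrite [RHS]addrC subrK.
  have := hg k _ Qk; move: iU; rewrite !mem_U mulnDl.
  move: (word_val w) (g k) => a b; lia.
have := ent_le R hS.
have -> : size (flatten [seq W k | k <- enum 'I_N]) = (N * ((2 * c + 2) * p ^ n))%N.
  rewrite size_flatten /shape -map_comp -[X in _ = (X * _)%N](size_enum_ord N).
  elim: (enum 'I_N) => //= k ks ->; rewrite mulSn; congr addn.
  by rewrite /W size_map size_U.
have N0 : (0 < N)%N by have [k _ _] := VX _ Xx0; apply: leq_ltn_trans (ltn_ord k).
rewrite /cylinder_entropy /scale_entropy !ln_natM // ?muln_gt0 ?P0 ?addn_gt0 ?orbT //; lra.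
Qed.

End Words.

(** The lower bound may lose an arbitrarily small slope, as the one from [fekete] does; the additive
    constants disappear on division by [ln (1 / e)]. *)
Lemma box_dim_eq (R : realType) (Y : set R) (s K : R) :
  (forall e, 0 < e -> e < 1 ->
     ln (covering_number e Y)%:R <= s * ln (1 / e) + K) ->
  (forall d, 0 < d -> exists K' : R, forall e, 0 < e -> e < 1 ->
     (s - d) * ln (1 / e) - K' <= ln (covering_number e Y)%:R) ->
  box_dim Y = s.
Proof.
move=> up low; apply/cvg_lim => //; apply/cvgrPdist_le => d d0.
have d20 : 0 < d / 2%:R by rewrite divr_gt0.
have [K' hK'] := low _ d20.
pose x := 1 + (2%:R * (`|K| + `|K'|)) / d.
have x0 : 0 < x by rewrite ltr_wpDr // divr_ge0 ?mulr_ge0 ?addr_ge0 // ltW.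
near=> e.
have e0 : 0 < e by near: e; exact: nbhs_right_gt.
have ex : e < expR (- x) by near: e; apply: nbhs_right_lt; exact: expR_gt0.
have e1 : e < 1 by apply: (lt_trans ex); rewrite expR_lt1 oppr_lt0.
set l := ln (1 / e).
have lx : x < l.
  rewrite /l div1r lnV ?posrE // -ltrN2 opprK -ltr_expR lnK ?posrE //.
have l0 : 0 < l by exact: lt_trans lx.
have := up e e0 e1; have := hK' e e0 e1; rewrite -/l.
move: (ln (covering_number e Y)%:R) => y h1 h2.
have hx : 2%:R * (`|K| + `|K'|) <= d * l.
  have : x * d < l * d by rewrite ltr_pM2r.
  by rewrite /x mulrDl mul1r divfK ?gt_eqF //; lra.
have -> : s - y / l = (s * l - y) / l by field; rewrite gt_eqF.
rewrite normrM [X in _ * X]gtr0_norm ?invr_gt0 // ler_pdivrMr // ler_norml.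
have := ler_norm K; have := ler_norm K'; have := normr_ge0 K; have := normr_ge0 K'.
by move=> ? ? ? ?; apply/andP; split; lra.
Unshelve. all: by end_near.
Qed.

(** The dimension is computed, not only bounded below: [box_dim] is a [lim], informative only once
    the quotient is known to converge. Hence the matching upper bounds, [up1] from a cover by
    intervals and [up2] from a cover by cylinders. *)
Lemma box_dim_no_overlap (R : realType) (L : finType) (p q c : nat) (d : L -> int)
    (f := fun (i : L) (x : R) => p%:R / q%:R * x + (d i)%:~R / c%:R) (X : set R) :
  (0 < p)%N -> (p < q)%N -> (0 < c)%N -> (0 < #|L|)%N ->
  ~ exact_overlaps f -> self_similar_set f X ->
  box_dim X = Num.min 1 (ln #|L|%:R / (ln q%:R - ln p%:R)).
Proof.
move=> p0 pq c0 L0 no_overlap XX; pose rr : R := p%:R / q%:R.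
have q0 : (0 < q)%N by exact: leq_ltn_trans pq.
have b0 : 0 < ln q%:R - ln p%:R :> R by exact: beta_gt0 p0 pq.
set beta := ln q%:R - ln p%:R in b0 *.
set D := [seq d i | i <- enum L].
have szD : size D = #|L| by rewrite size_map -cardE.
have D0 : (0 < size D)%N by rewrite szD.
pose M := (\sum_(i : L) `|d i|)%N.
have DM : {in D, forall x, `|x| <= M%:Z}.
  move=> _ /mapP[i _ ->]; rewrite -abszE lez_nat /M (bigD1 i) //=.
  exact: leq_addr.
have uS := uniq_S pq c0 no_overlap.
have [alpha [a0 hup hlow]] := h_alpha R p0 pq D0 DM.
have amin := growth_rate_ge p0 pq D0 DM uS a0 hup hlow.
rewrite szD -/beta in amin.
have [[x0 Xx0] cX _] := XX.
have [B [_ hB]] := compact_bounded cX.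
pose b := `|B| + 1.
have Xb y : X y -> `|y| <= b.
  move=> Xy; apply: (hB b _ y Xy); rewrite /b; apply: (le_lt_trans (ler_norm B)).
  by rewrite ltrDl.
have b1 : 1 <= b by rewrite lerDr.
have lnrr n : ln (rr ^+ n) = - (n%:R * beta).
  rewrite lnXn ?divr_gt0 ?ltr0n // ln_div ?posrE ?ltr0n // -[_ *+ n]mulr_natl /beta; ring.
have rr0 n : 0 < rr ^+ n by rewrite exprn_gt0 // divr_gt0 ?ltr0n.
have lnL : 0 <= ln #|L|%:R :> R by exact: ln_nat_ge0.
set mu := Num.min (ln #|L|%:R) beta in amin.
have mu0 : 0 <= mu by rewrite le_min lnL ltW.
have muE : Num.min 1 (ln #|L|%:R / beta) = mu / beta.
  rewrite /mu minr_pMl ?invr_ge0 ?(ltW b0) // divff ?gt_eqF //; exact: minC.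
have cov e : 0 < e -> coverable e X (Num.truncn (2%:R * b / e)).+2.
  move=> e0; apply: (coverable_interval e0 Xb).
  by rewrite -ler_pdivrMr // ltW // truncnS_gt.
have Npos e : 0 < e -> (0 < covering_number e X)%N.
  move=> e0; have [[V [_ VX]] _] := covering_numberP (cov e e0).
  by have [k _ _] := VX _ Xx0; apply: leq_ltn_trans (ltn_ord k).
have lne e : 0 < e -> ln (1 / e) = - ln e by move=> e0; rewrite div1r lnV.
have up1 e : 0 < e -> e < 1 ->
    ln (covering_number e X)%:R <= ln (1 / e) + ln (2%:R * b + 2%:R).
  move=> e0 e1; have [_ /(_ _ (cov e e0)) hN] := covering_numberP (cov e e0).
  have b2 : 0 < 2%:R * b + 2%:R by lra.
  have ie : 0 < 1 / e by rewrite divr_gt0.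
  have pe : 0 < 1 / e * (2%:R * b + 2%:R) by rewrite mulr_gt0.
  rewrite -lnM ?posrE // ler_ln ?posrE ?ltr0n ?Npos //.
  apply: (@le_trans _ _ (2%:R * b / e + 2%:R)).
    apply: (@le_trans _ _ (Num.truncn (2%:R * b / e)).+2%:R); first by rewrite ler_nat.
    have z0 : 0 <= 2%:R * b / e by rewrite divr_ge0 ?(ltW e0) //; lra.
    have /andP[z1 _] := truncn_itv z0.
    rewrite -addn2 natrD; move: z1; clear; lra.
  have : 1 <= e^-1 by rewrite invr_ge1 ?unitfE ?gt_eqF // ltW.
  rewrite div1r; clear; lra.
have up2 e : 0 < e -> e < 1 ->
    ln (covering_number e X)%:R <= ln #|L|%:R / beta * ln (1 / e) +
      ln #|L|%:R * (ln (2%:R * b) / beta + 1).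
  (* Enough letters for the cylinders of length [n] to have diameter at most [e]. *)
  move=> e0 e1; pose n := (Num.truncn ((ln (1 / e) + ln (2%:R * b)) / beta)).+1.
  have b2 : 0 < 2%:R * b by lra.
  have y0 : 0 <= ln (1 / e) + ln (2%:R * b).
    by rewrite addr_ge0 // ln_ge0 //; [rewrite div1r invr_ge1 ?unitfE ?gt_eqF // ltW|lra].
  have z0 : 0 <= (ln (1 / e) + ln (2%:R * b)) / beta by rewrite divr_ge0 // ltW.
  have /andP[z1 z2] := truncn_itv z0.
  have hn : 2%:R * b * rr ^+ n <= e.
    have pr : 0 < 2%:R * b * rr ^+ n by exact: mulr_gt0.
    rewrite -ler_ln ?posrE // lnM ?posrE // lnrr.
    have : ln (1 / e) + ln (2%:R * b) < n%:R * beta by rewrite -ltr_pdivrMr.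
    rewrite lne //; clear; lra.
  have cw := coverable_words p0 pq c0 XX Xb hn.
  have [_ /(_ _ cw) hN] := covering_numberP (cov e e0).
  apply: (le_trans (ler_ln_nat R hN)); rewrite ln_natX //.
  have : n%:R <= (ln (1 / e) + ln (2%:R * b)) / beta + 1 by rewrite /n -natr1 lerD2r.
  move=> /(ler_wpM2r lnL) /le_trans; apply.
  by rewrite le_eqVlt; apply/orP; left; apply/eqP; field; rewrite gt_eqF.
rewrite muE.
pose K := `|ln (2%:R * b + 2%:R)| + `|ln #|L|%:R * (ln (2%:R * b) / beta + 1)|.
apply: (@box_dim_eq _ _ _ K).
  move=> e e0 e1; have := up1 e e0 e1; have := up2 e e0 e1; rewrite -muE /K.
  set A := ln (2%:R * b + 2%:R); set A' := ln #|L|%:R * (_ + 1).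
  have := ler_norm A; have := ler_norm A'; have := normr_ge0 A; have := normr_ge0 A'.
  by rewrite /Num.min; case: ifP => _; clear; lra.
move=> e' e'0; have [K1 K10 hK1] := hlow (e' * beta) (mulr_gt0 e'0 b0).
exists (mu + K1 + ln (2 * c + 2)%:R) => e e0 e1.
have l0 : 0 <= ln (1 / e) by rewrite ln_ge0 // div1r invr_ge1 ?unitfE ?gt_eqF // ltW.
have z0 : 0 <= ln (1 / e) / beta by rewrite divr_ge0 // ltW.
(* The largest [n] with [r^n >= e], as [h_le_coverable] requires. *)
pose n := Num.truncn (ln (1 / e) / beta).
have /andP[z1 z2] := truncn_itv z0; rewrite -/n in z1 z2.
have en : e <= rr ^+ n.
  rewrite -ler_ln ?posrE // lnrr; move: z1; rewrite ler_pdivlMr // lne //; clear; lra.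
have [cc _] := covering_numberP (cov e e0).
have := h_le_coverable p0 pq c0 XX en cc; have := hK1 n; rewrite -/D.
have n0 : 0 <= n%:R :> R by [].
have h1 : mu * (ln (1 / e) / beta - 1) <= mu * n%:R.
  by apply: ler_wpM2l => //; move: z2; rewrite -natr1; clear; lra.
have h2 : mu * n%:R <= alpha * n%:R by apply: ler_wpM2r.
have h3 : e' * beta * n%:R <= e' * beta * (ln (1 / e) / beta).
  by apply: ler_wpM2l => //; rewrite mulr_ge0 // ltW.
have h4 : e' * beta * (ln (1 / e) / beta) = e' * ln (1 / e).
  by field; rewrite gt_eqF.
move: h1 h2 h3 h4; clear; lra.
Qed.

(** * Reduction to integer data *)

Lemma common_denominator (L : finType) (a : L -> rat) :
  exists c : nat, (0 < c)%N /\ exists d : L -> int, forall i, a i = (d i)%:~R / c%:R.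
Proof.
pose c := (\prod_(i : L) `|denq (a i)|)%N; exists c.
have c0 : (0 < c)%N by rewrite prodn_gt0 // => i; rewrite absz_gt0 denq_neq0.
split => //; exists (fun i => numq (a i) * (c %/ `|denq (a i)|)%N%:Z) => i.
have dc : (`|denq (a i)| %| c)%N by rewrite /c (bigD1 i) //= dvdn_mulr.
have e : c%:R = (c %/ `|denq (a i)|)%N%:R * (denq (a i))%:~R :> rat.
  by rewrite -[in LHS](divnK dc) natrM; congr (_ * _); rewrite pmulrn absz_denq.
have den0 : (denq (a i))%:~R != 0 :> rat by rewrite intr_eq0 denq_neq0.
have c1 : c%:R != 0 :> rat by rewrite pnatr_eq0 -lt0n.
have k0 : (c %/ `|denq (a i)|)%N%:R != 0 :> rat.
  by move: c1; rewrite e mulf_eq0 negb_or => /andP[].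
rewrite -{1}(divq_num_den (a i)) e intrM -pmulrn; field.
by rewrite den0 k0.
Qed.

Theorem proposition1p3 (R : realType) (L : finType) (r : rat) (a : L -> rat)
    (X : set R) :
  0 < r -> r < 1 ->
  (exists i j : L, @ifs_map R L r a i <> @ifs_map R L r a j) ->
  self_similar_set (@ifs_map R L r a) X ->
  box_dim X < Num.min 1 (ln #|L|%:R / ln (1 / ratr r)) ->
  exact_overlaps (@ifs_map R L r a).
Proof.
move=> r0 r1 [i0 _] XX dimX; apply: contrapT => no_overlap.
have L0 : (0 < #|L|)%N by apply/card_gt0P; exists i0.
have [c [c0 [d ad]]] := common_denominator a.
pose p := `|numq r|%N; pose q := `|denq r|%N.
have p0 : (0 < p)%N by rewrite absz_gt0 numq_eq0 gt_eqF.
have q0 : (0 < q)%N by rewrite absz_gt0 denq_neq0.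
have rE : r = p%:R / q%:R.
  rewrite -[LHS]divq_num_den /p /q !pmulrn absz_denq gez0_abs //.
  by rewrite numq_ge0 ltW.
have pq : (p < q)%N.
  by move: r1; rewrite rE ltr_pdivrMr ?ltr0n // mul1r ltr_nat.
have rR : ratr r = p%:R / q%:R :> R by rewrite rE fmorph_div /= !ratr_nat.
have fE : @ifs_map R L r a = fun i x => p%:R / q%:R * x + (d i)%:~R / c%:R.
  apply/funext => i; apply/funext => x.
  by rewrite /ifs_map rR ad fmorph_div /= ratr_int ratr_nat.
rewrite fE in XX no_overlap.
move: dimX; rewrite (box_dim_no_overlap p0 pq c0 L0 no_overlap XX) rR.
by rewrite div1r invf_div ln_div ?posrE ?ltr0n // ltxx.
Qed.
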